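(* (i) A basis over $\mathbf{Z}_2$ for $H^*(bo)=\mathcal{A}\otimes_{\mathcal{A}_1}\mathbf{Z}_2$ is given by (the images of) all $Sq^I$ with $I=(i_1,\ldots,i_k)$ admissible such that no $i_s$ is of the form $2^n+1$ with $n\ge 1$, and $i_k\ge 4$. (ii) A basis over $\mathbf{Z}_2$ for $H^*(bu)=\mathcal{A}\otimes_{E_1}\mathbf{Z}_2$ is given by (the images of) all $Sq^I$ with $I=(i_1,\ldots,i_k)$ admissible such that no $i_s$ is of the form $2^n+1$ with $n\ge 1$, and $i_k\ge 2$. In both cases the empty sequence $I$ (with $Sq^I=1$) is included.
   Context: $\mathbf{Z}_2$ denotes the integers mod 2 and $\mathcal{A}$ is the mod 2 Steenrod algebra. For a finite sequence of positive integers $I=(i_1,\ldots,i_k)$, $Sq^I=Sq^{i_1}Sq^{i_2}\cdots Sq^{i_k}$; for the empty sequence $Sq^I=1$. The sequence $I$ is admissible if $i_s\ge 2i_{s+1}$ for all $1\le s<k$ (the empty sequence is admissible). $\mathcal{A}_1\subset\mathcal{A}$ is the subalgebra generated by $Sq^1$ and $Sq^2$; $E_1\subset\mathcal{A}$ is the subalgebra generated by $Q_0=Sq^1$ and $Q_1=Sq^1Sq^2+Sq^2Sq^1$. For $B=\mathcal{A}_1$ or $E_1$, $\mathcal{A}/\!\!/B=\mathcal{A}\otimes_B\mathbf{Z}_2$ is the quotient of $\mathcal{A}$ by the left ideal generated by the positive-degree elements of $B$. The spectra $bo$ and $bu$ are the connective real and complex K-theory spectra, and $H^*$ is mod 2 cohomology;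 it is known (Stong) that $H^*(bo)\cong\mathcal{A}/\!\!/\mathcal{A}_1$ and $H^*(bu)\cong\mathcal{A}/\!\!/E_1$ as left $\mathcal{A}$-modules, generated by the nonzero class in degree $0$. The image of $Sq^I$ is its class in the quotient, i.e. $Sq^I$ applied to this generator. *)

(* Defs.v *)
From HB Require Import structures.
From mathcomp Require Import all_boot all_order all_algebra.
From mathcomp Require Import boolp.
From mathcomp Require Import monalg.

Set Implicit Arguments.
Unset Strict Implicit.
Unset Printing Implicit Defensive.

Import GRing.Theory.
Local Open Scope ring_scope.
Local Open Scope quotient_scope.

Section Generated.
Context {K : nzRingType} {A : lalgType K}.

Definition two_sided_ideal (G : A -> Prop) : pred A := fun x =>
  `[< exists2 s : seq (A * A * A), (forall t, t \in s -> G t.1.2) &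
        x = \sum_(t <- s) t.1.1 * t.1.2 * t.2 >].

Definition left_ideal (G : A -> Prop) : pred A := fun x =>
  `[< exists2 s : seq (A * A), (forall t, t \in s -> G t.2) &
        x = \sum_(t <- s) t.1 * t.2 >].

Inductive subalgebra (G : A -> Prop) : A -> Prop :=
| subalgebra_gen x : G x -> subalgebra G x
| subalgebra_one : subalgebra G 1
| subalgebra_add x y : subalgebra G x -> subalgebra G y -> subalgebra G (x + y)
| subalgebra_mul x y : subalgebra G x -> subalgebra G y -> subalgebra G (x * y)
| subalgebra_scale c x : subalgebra G x -> subalgebra G (c *: x).

Variable G : A -> Prop.

Lemma two_sided_idealP x :
  reflect (exists2 s : seq (A * A * A), (forall t, t \in s -> G t.1.2) &
             x = \sum_(t <- s) t.1.1 * t.1.2 * t.2)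
    (x \in two_sided_ideal G).
Proof. exact: asboolP. Qed.

Lemma left_idealP x :
  reflect (exists2 s : seq (A * A), (forall t, t \in s -> G t.2) &
             x = \sum_(t <- s) t.1 * t.2)
    (x \in left_ideal G).
Proof. exact: asboolP. Qed.

Lemma two_sided_ideal_zmod : zmod_closed (two_sided_ideal G).
Proof.
split=> [|x y /two_sided_idealP[s sG ->] /two_sided_idealP[t tG ->]];
  apply/two_sided_idealP.
  by exists [::] => //; rewrite big_nil.
exists (s ++ [seq (- u.1.1, u.1.2, u.2) | u <- t]).
  move=> u; rewrite mem_cat => /orP[/sG //|/mapP[v vt ->]]; exact: (tG v).
rewrite big_cat big_map -sumrN; congr (_ + _).
by apply: eq_bigr => u _; rewrite /= !mulNr.
Qed.

Lemma left_ideal_zmod : zmod_closed (left_ideal G).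
Proof.
split=> [|x y /left_idealP[s sG ->] /left_idealP[t tG ->]];
  apply/left_idealP.
  by exists [::] => //; rewrite big_nil.
exists (s ++ [seq (- u.1, u.2) | u <- t]).
  move=> u; rewrite mem_cat => /orP[/sG //|/mapP[v vt ->]]; exact: (tG v).
rewrite big_cat big_map -sumrN; congr (_ + _).
by apply: eq_bigr => u _; rewrite /= !mulNr.
Qed.

HB.instance Definition _ :=
  GRing.isZmodClosed.Build A (two_sided_ideal G) two_sided_ideal_zmod.
HB.instance Definition _ :=
  GRing.isZmodClosed.Build A (left_ideal G) left_ideal_zmod.

Lemma two_sided_idealMl a x :
  x \in two_sided_ideal G -> a * x \in two_sided_ideal G.
Proof.
case/two_sided_idealP=> s sG ->; apply/two_sided_idealP.
exists [seq (a * u.1.1, u.1.2, u.2) | u <- s].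
  by move=> u /mapP[v vs ->]; exact: (sG v).
by rewrite big_map mulr_sumr; apply: eq_bigr => u _; rewrite !mulrA.
Qed.

Lemma two_sided_idealMr a x :
  x \in two_sided_ideal G -> x * a \in two_sided_ideal G.
Proof.
case/two_sided_idealP=> s sG ->; apply/two_sided_idealP.
exists [seq (u.1.1, u.1.2, u.2 * a) | u <- s].
  by move=> u /mapP[v vs ->]; exact: (sG v).
by rewrite big_map mulr_suml; apply: eq_bigr => u _; rewrite !mulrA.
Qed.

Lemma two_sided_idealZ c x :
  x \in two_sided_ideal G -> c *: x \in two_sided_ideal G.
Proof. by move=> xI; rewrite -[x]mul1r scalerAl; exact: two_sided_idealMl. Qed.

Lemma left_idealMl a x : x \in left_ideal G -> a * x \in left_ideal G.
Proof.
case/left_idealP=> s sG ->; apply/left_idealP.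
exists [seq (a * u.1, u.2) | u <- s].
  by move=> u /mapP[v vs ->]; exact: (sG v).
by rewrite big_map mulr_sumr; apply: eq_bigr => u _; rewrite !mulrA.
Qed.

Lemma left_idealZ c x : x \in left_ideal G -> c *: x \in left_ideal G.
Proof. by move=> xI; rewrite -[x]mul1r scalerAl; exact: left_idealMl. Qed.

End Generated.

(* Bases of possibly infinite-dimensional modules: the family [e], indexed by
   the [j] satisfying [P], is linearly independent (in particular injective)
   and spans. *)
Definition is_basis (K : nzRingType) (V : lmodType K) (J : eqType)
    (P : J -> Prop) (e : J -> V) : Prop :=
  (forall (s : seq J) (c : J -> K), uniq s -> (forall j, j \in s -> P j) ->
     \sum_(j <- s) c j *: e j = 0 -> forall j, j \in s -> c j = 0)
  /\
  (forall v : V, exists (s : seq J) (c : J -> K),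
     (forall j, j \in s -> P j) /\ v = \sum_(j <- s) c j *: e j).

(* The mod 2 Steenrod algebra is presented by generators Sq^i, i >= 0, subject
   to Sq^0 = 1 and the Adem relations; words in the generators form the free
   monoid on nat. *)
Definition free_steenrod : Type := {malg 'F_2[{fmonom nat}]}.
HB.instance Definition _ := GRing.Lalgebra.on free_steenrod.

Definition free_Sq (i : nat) : free_steenrod := << fmu i >>.

Definition adem (a b : nat) : free_steenrod :=
  free_Sq a * free_Sq b
  - \sum_(c < a./2.+1)
      'C(b - c - 1, a - 2 * c)%:R *: (free_Sq (a + b - c) * free_Sq c).

Variant steenrod_relation : free_steenrod -> Prop :=
| Sq0_relation : steenrod_relation (free_Sq 0 - 1)
| adem_relation a b : (0 < a < 2 * b)%N -> steenrod_relation (adem a b).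

Definition steenrod_ideal : pred free_steenrod :=
  two_sided_ideal steenrod_relation.
HB.instance Definition _ :=
  GRing.isZmodClosed.Build free_steenrod steenrod_ideal
    (two_sided_ideal_zmod steenrod_relation).

Definition steenrod : Type :=
  {ideal_quot (GRing.ZmodClosed.clone free_steenrod steenrod_ideal _)}.
HB.instance Definition _ := GRing.Zmodule.on steenrod.
HB.instance Definition _ := EqQuotient.on steenrod.

Section SteenrodRing.

Lemma steenrod_piE (x y : free_steenrod) :
  (\pi_steenrod x == \pi_steenrod y) = (x - y \in steenrod_ideal).
Proof. exact/esym/Quotient.idealrBE. Qed.

Lemma steenrod_piD (x y : free_steenrod) :
  \pi_steenrod (x + y) = \pi_steenrod x + \pi_steenrod y.
Proof. exact: Quotient.pi_add. Qed.

Definition steenrod_one : steenrod := \pi_steenrod 1.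
Definition steenrod_mul := lift_op2 steenrod *%R.
Definition steenrod_scale (c : 'F_2) := lift_op1 steenrod ( *:%R c).

Lemma steenrod_pi_mul x y :
  steenrod_mul (\pi_steenrod x) (\pi_steenrod y) = \pi_steenrod (x * y).
Proof.
unlock steenrod_mul; apply/eqP; rewrite steenrod_piE.
set x' := repr _; set y' := repr _.
have Ix : x' - x \in steenrod_ideal by rewrite -steenrod_piE reprK.
have Iy : y' - y \in steenrod_ideal by rewrite -steenrod_piE reprK.
have -> : x' * y' - x * y = x' * (y' - y) + (x' - x) * y.
  by rewrite mulrBr mulrBl addrA subrK.
by apply: rpredD; [exact: two_sided_idealMl | exact: two_sided_idealMr].
Qed.

Lemma steenrod_pi_scale c x :
  steenrod_scale c (\pi_steenrod x) = \pi_steenrod (c *: x).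
Proof.
unlock steenrod_scale; apply/eqP; rewrite steenrod_piE -scalerBr.
by apply: two_sided_idealZ; rewrite -steenrod_piE reprK.
Qed.

Fact steenrod_mulA : associative steenrod_mul.
Proof.
by move=> x y z; rewrite -[x]reprK -[y]reprK -[z]reprK !steenrod_pi_mul mulrA.
Qed.
Fact steenrod_mul1 : left_id steenrod_one steenrod_mul.
Proof. by move=> x; rewrite -[x]reprK steenrod_pi_mul mul1r. Qed.
Fact steenrod_mulr1 : right_id steenrod_one steenrod_mul.
Proof. by move=> x; rewrite -[x]reprK steenrod_pi_mul mulr1. Qed.
Fact steenrod_mulDl : left_distributive steenrod_mul +%R.
Proof.
move=> x y z; rewrite -[x]reprK -[y]reprK -[z]reprK.
by rewrite !steenrod_pi_mul -!steenrod_piD steenrod_pi_mul mulrDl.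
Qed.
Fact steenrod_mulDr : right_distributive steenrod_mul +%R.
Proof.
move=> x y z; rewrite -[x]reprK -[y]reprK -[z]reprK.
by rewrite !steenrod_pi_mul -!steenrod_piD steenrod_pi_mul mulrDr.
Qed.

Definition word_augmentation (w : {fmonom nat}) : 'F_2 := (all (pred1 0%N) w)%:R.

Fact word_augmentation_morphism : mmorphism word_augmentation.
Proof.
split=> [v w|]; rewrite /word_augmentation; last by rewrite fm1.
by rewrite fmM all_cat -natrM mulnb.
Qed.
HB.instance Definition _ :=
  isMultiplicative.Build _ _ word_augmentation word_augmentation_morphism.

(* The augmentation Sq^i |-> 0 for i > 0 shows that the quotient is nonzero. *)
Definition augmentation : {rmorphism free_steenrod -> 'F_2} :=
  mmap (idfun : {rmorphism 'F_2 -> 'F_2}) word_augmentation.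

Lemma augmentation_Sq i : augmentation (free_Sq i) = (i == 0%N)%:R.
Proof.
by rewrite /augmentation /free_Sq /= mmapU mul1r /word_augmentation fmU /= andbT.
Qed.

Lemma augmentation_scale c x : augmentation (c *: x) = c * augmentation x.
Proof. exact: (@mmapZ _ _ _ idfun). Qed.

Lemma augmentation_relation x : steenrod_relation x -> augmentation x = 0.
Proof.
case=> [|a b /andP[a_gt0 a_lt]].
  by rewrite rmorphB rmorph1 augmentation_Sq subrr.
rewrite rmorphB rmorphM rmorph_sum !augmentation_Sq eqn0Ngt a_gt0 mul0r sub0r.
rewrite big1 ?oppr0 // => c _; rewrite augmentation_scale rmorphM !augmentation_Sq.
have c_lt : (c < a + b)%N.
  apply: leq_trans (ltn_ord c) _; rewrite (leq_trans _ (leq_addr b a)) //.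
  by rewrite ltn_half_double -addnn -{1}[a]addn0 ltn_add2l.
by rewrite eqn0Ngt subn_gt0 c_lt mul0r mulr0.
Qed.

Fact steenrod_one_neq0 : steenrod_one != 0.
Proof.
have -> : (0 : steenrod) = \pi_steenrod 0.
  by apply: (addrI (\pi_steenrod 0)); rewrite -steenrod_piD !addr0.
rewrite steenrod_piE subr0; apply/negP => /two_sided_idealP[s sG e].
have : augmentation 1 = 0.
  rewrite e rmorph_sum big_seq big1 // => t /sG rt.
  by rewrite !rmorphM (augmentation_relation rt) mulr0 mul0r.
by rewrite rmorph1 => /eqP; rewrite oner_eq0.
Qed.

End SteenrodRing.


HB.instance Definition _ := GRing.Zmodule_isNzRing.Build steenrod
  steenrod_mulA steenrod_mul1 steenrod_mulr1 steenrod_mulDl steenrod_mulDr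
  steenrod_one_neq0.

Section SteenrodAlgebra.

Fact steenrod_scaleA c d x :
  steenrod_scale c (steenrod_scale d x) = steenrod_scale (c * d) x.
Proof. by rewrite -[x]reprK !steenrod_pi_scale scalerA. Qed.
Fact steenrod_scale1 : left_id 1 steenrod_scale.
Proof. by move=> x; rewrite -[x]reprK steenrod_pi_scale scale1r. Qed.
Fact steenrod_scaleDr : right_distributive steenrod_scale +%R.
Proof.
move=> c x y; rewrite -[x]reprK -[y]reprK.
by rewrite -steenrod_piD !steenrod_pi_scale -steenrod_piD scalerDr.
Qed.
Fact steenrod_scaleDl x : {morph steenrod_scale^~ x : c d / c + d}.
Proof.
by move=> c d; rewrite -[x]reprK !steenrod_pi_scale -steenrod_piD scalerDl.
Qed.

HB.instance Definition _ := GRing.Zmodule_isLmodule.Build 'F_2 steenrod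
  steenrod_scaleA steenrod_scale1 steenrod_scaleDr steenrod_scaleDl.

Lemma steenrod_piM (x y : free_steenrod) :
  \pi_steenrod (x * y) = \pi_steenrod x * \pi_steenrod y.
Proof. exact/esym/steenrod_pi_mul. Qed.
Lemma steenrod_piZ (c : 'F_2) (x : free_steenrod) :
  \pi_steenrod (c *: x) = c *: \pi_steenrod x.
Proof. exact/esym/steenrod_pi_scale. Qed.

Fact steenrod_scaleAl (c : 'F_2) (x y : steenrod) : c *: (x * y) = c *: x * y.
Proof.
by rewrite -[x]reprK -[y]reprK -steenrod_piZ -!steenrod_piM -steenrod_piZ scalerAl.
Qed.

HB.instance Definition _ :=
  GRing.Lmodule_isLalgebra.Build 'F_2 steenrod steenrod_scaleAl.

Fact steenrod_scaleAr (c : 'F_2) (x y : steenrod) : c *: (x * y) = x * (c *: y).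
Proof.
by case: c => [[|[]]] // i; rewrite -[Ordinal _]natr_Zp ?scale0r ?mulr0 ?scale1r.
Qed.

HB.instance Definition _ :=
  GRing.Lalgebra_isAlgebra.Build 'F_2 steenrod steenrod_scaleAr.

End SteenrodAlgebra.

Section LeftQuotient.
Context {K : nzRingType} {A : lalgType K} (G : A -> Prop).

Definition left_quotient : Type :=
  {ideal_quot (GRing.ZmodClosed.clone A (left_ideal G) _)}.
HB.instance Definition _ := GRing.Zmodule.on left_quotient.
HB.instance Definition _ := EqQuotient.on left_quotient.

Definition left_quotient_scale (c : K) := lift_op1 left_quotient ( *:%R c).

Lemma left_quotient_piE (x y : A) :
  (\pi_left_quotient x == \pi_left_quotient y) = (x - y \in left_ideal G).
Proof. exact/esym/Quotient.idealrBE. Qed.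

Lemma left_quotient_pi_scale c x :
  left_quotient_scale c (\pi_left_quotient x) = \pi_left_quotient (c *: x).
Proof.
unlock left_quotient_scale; apply/eqP; rewrite left_quotient_piE -scalerBr.
by apply: left_idealZ; rewrite -left_quotient_piE reprK.
Qed.

Lemma left_quotient_piD (x y : A) :
  \pi_left_quotient (x + y) = \pi_left_quotient x + \pi_left_quotient y.
Proof. exact: Quotient.pi_add. Qed.

Fact left_quotient_scaleA c d x :
  left_quotient_scale c (left_quotient_scale d x) =
  left_quotient_scale (c * d) x.
Proof. by rewrite -[x]reprK !left_quotient_pi_scale scalerA. Qed.
Fact left_quotient_scale1 : left_id 1 left_quotient_scale.
Proof. by move=> x; rewrite -[x]reprK left_quotient_pi_scale scale1r. Qed.
Fact left_quotient_scaleDr : right_distributive left_quotient_scale +%R.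
Proof.
move=> c x y; rewrite -[x]reprK -[y]reprK.
by rewrite -left_quotient_piD !left_quotient_pi_scale -left_quotient_piD scalerDr.
Qed.
Fact left_quotient_scaleDl x : {morph left_quotient_scale^~ x : c d / c + d}.
Proof.
by move=> c d; rewrite -[x]reprK !left_quotient_pi_scale -left_quotient_piD scalerDl.
Qed.

HB.instance Definition _ := GRing.Zmodule_isLmodule.Build K left_quotient
  left_quotient_scaleA left_quotient_scale1
  left_quotient_scaleDr left_quotient_scaleDl.

Lemma left_quotient_piZ (c : K) (x : A) :
  \pi_left_quotient (c *: x) = c *: \pi_left_quotient x.
Proof. exact/esym/left_quotient_pi_scale. Qed.

End LeftQuotient.

Definition Sq (i : nat) : steenrod := \pi_steenrod (free_Sq i).
Definition SqI (I : seq nat) : steenrod := \prod_(i <- I) Sq i.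

(* The grading with Sq^i in degree i; it descends to the quotient because the
   Adem relations are homogeneous. *)
Definition homogeneous (d : nat) (x : steenrod) : Prop :=
  exists2 f : free_steenrod,
    (forall w : {fmonom nat}, f@_w != 0 -> sumn w = d) & x = \pi_steenrod f.

Definition positive_part (B : steenrod -> Prop) (x : steenrod) : Prop :=
  B x /\ exists2 d, (0 < d)%N & homogeneous d x.

Definition A1 : steenrod -> Prop :=
  subalgebra (fun x => x = Sq 1 \/ x = Sq 2).

Definition Q0 : steenrod := Sq 1.
Definition Q1 : steenrod := Sq 1 * Sq 2 + Sq 2 * Sq 1.
Definition E1 : steenrod -> Prop := subalgebra (fun x => x = Q0 \/ x = Q1).

(* A // B = A (x)_B Z_2 *)
Definition steenrod_mod (B : steenrod -> Prop) : Type :=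
  left_quotient (positive_part B).
HB.instance Definition _ B := GRing.Lmodule.on (steenrod_mod B).
HB.instance Definition _ B := EqQuotient.on (steenrod_mod B).

Definition admissible (I : seq nat) : bool :=
  all (ltn 0) I && sorted (fun i j => 2 * j <= i)%N I.

Definition avoids_2n1 (I : seq nat) : Prop :=
  forall i n, i \in I -> (1 <= n)%N -> i <> (2 ^ n + 1)%N.

Definition last_ge (m : nat) (I : seq nat) : Prop :=
  I <> [::] -> (m <= last 0%N I)%N.

(* Main.v *)
(* The ideals A E_1^+ and A A_1^+ equal A Q_0 + A Q_1 and A Sq^1 + A Sq^2.

   Every sequence J as in (ii) satisfies
     Sq^J Q_1 = Sq^I + (lexicographically smaller admissible monomials)  mod A Sq^1,
   where I is admissible, does not end in 1, and contains an entry 2^n + 1; here J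
   is a function of I, and every such I occurs.  This rewrites the
   excluded admissible monomials modulo A E_1^+ in terms of smaller ones, whence
   spanning in (ii).  For independence, a relation sum Sq^I = x Q_0 + y Q_1 with y
   reduced by spanning becomes, as Q_0 Q_1 and Q_1^2 lie in A Q_0, a relation modulo
   A Sq^1 between the Sq^I and some Sq^J Q_1, whose leading terms are distinct
   admissible sequences.  Part (i) follows in the same way from (ii) by right
   multiplication with Sq^2, which maps the sequences with last entry >= 4 to
   sequences (..., 2) of (ii).

   Linear independence of the admissible monomials themselves is Serre's argument:
   evaluate on X_1 ... X_n in a polynomial ring, and look at the coefficient of
   the highest power of the last variable.  The Adem relations hold there by
   induction, since they are compatible with multiplication by a variable. *)

From HB Require Import structures.
Require Import Defs.
From mathcomp Require Import all_boot all_order all_algebra.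
From mathcomp Require Import monalg boolp zify.
Set Implicit Arguments.
Unset Strict Implicit.
Unset Printing Implicit Defensive.
Import GRing.Theory.
Local Open Scope ring_scope.
Local Open Scope quotient_scope.

(** * Adem relations on polynomial rings *)

(* The guard discards the range where the truncated [a - 2 * c] would be [0]. *)
Definition adem_coeff (a b c : nat) : nat :=
  if (2 * c <= a)%N then 'C(b - c - 1, a - 2 * c) else 0.

(** The sum is padded by zero coefficients up to [a + b], so that shifts of the indices only reindex
    it. The case [a = 0] is included and reads [F 0 b = F b 0]. *)
Definition adem_holds (V : zmodType) (F : nat -> nat -> V) : Prop :=
  forall a b, (a < 2 * b)%N ->
    F a b = \sum_(c < (a + b).+1) F (a + b - c)%N c *+ adem_coeff a b c.

Section AdemShift.
Variables (V : zmodType) (F : nat -> nat -> V).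
Hypothesis V2 : forall x : V, x *+ 2 = 0.
Hypothesis F_adem : adem_holds F.

Let mulrn_odd (x : V) n : x *+ n = x *+ odd n.
Proof. by rewrite -{1}(odd_double_half n) mulrnDr -mul2n mulrnA V2 mul0rn addr0. Qed.

(** If [F a b] is Sq^a Sq^b p, the Cartan formula for Sq^a Sq^b (p X) produces [adem_shift1] and
    [adem_shift2] in front of X^2, and [adem_shift3] in front of X^4. *)
Definition adem_shift1 a b := if a is a'.+1 then F a' b else 0.
Definition adem_shift2 a b := if b is b'.+1 then F a b' else 0.
Definition adem_shift3 a b := if a is a'.+2 then adem_shift2 a' b else 0.

(** This is the relation for [a - 2] and [b - 1]: replacing [c] by [c + 1] preserves the binomial
    coefficients. *)
Lemma adem_holds_shift3 : adem_holds adem_shift3.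
Proof.
move=> [|[|a]] b; [| |case: b => // b] => hab.
- rewrite big_ord_recl big1 /=; last by move=> i _; rewrite /adem_coeff /= mulr0n.
  by rewrite addr0 subn0; case: b hab => // -[|b] _; rewrite /= mul0rn.
- rewrite big_ord_recl big1 /=; last first.
    by move=> i _; rewrite /adem_coeff /bump /= ifF ?mulr0n //; lia.
  by rewrite addr0; case: b hab => // b _; rewrite /= mul0rn.
rewrite big_ord_recl /adem_shift3 subn0 /= mul0rn add0r.
rewrite F_adem; last by lia.
rewrite (_ : (a.+2 + b.+1) = (a + b).+1.+2)%N; last by lia.
rewrite [RHS]big_ord_recr [X in _ = _ + X](_ : _ = 0) ?addr0; last first.
  by rewrite /adem_coeff /bump /= ifF ?mulr0n //; lia.
rewrite [RHS]big_ord_recr [X in _ = _ + X](_ : _ = 0) ?addr0; last first.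
  by rewrite /adem_coeff /bump /= ifF ?mulr0n //; lia.
apply: eq_bigr => c _; rewrite /bump /= add1n.
rewrite (_ : ((a + b).+3 - c.+1 = (a + b - c).+2)%N); last by have := ltn_ord c; lia.
by rewrite /= /adem_coeff; congr (_ *+ _); case: ifP; case: ifP => *; try lia;
  congr 'C(_, _); lia.
Qed.

Lemma adem_holds_shift12 :
  adem_holds (fun a b => adem_shift1 a b + adem_shift2 a b).
Proof.
move=> a [|b] hab; first by lia.
have F1 : adem_shift1 a b.+1 = \sum_(c < (a + b).+1)
    F (a + b - c)%N c *+ (if (2 * c < a)%N then 'C(b - c, a - 2 * c - 1) else 0).
  case: a hab => [|a] hab /=; first by rewrite big1 // => c _; rewrite mulr0n.
  rewrite F_adem; last by lia.
  rewrite addnS addSn; apply: eq_bigr => c _; congr (_ *+ _).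
  by rewrite /adem_coeff ltnS; case: ifP => // ?; congr 'C(_, _); lia.
(* For [a = 2 * b] and [a = 2 * b + 1] no relation applies to [F a b]; it is kept as the single term
   [c = b], hence the coefficient 1. *)
have F2 : F a b = \sum_(c < (a + b).+1) F (a + b - c)%N c *+
    (if (2 * c <= a)%N then if (c < b)%N then 'C(b - c - 1, a - 2 * c) else 1 else 0).
  have [lt_a|ge_a] := ltnP a (2 * b).
    rewrite F_adem //; apply: eq_bigr => c _; congr (_ *+ _).
    by rewrite /adem_coeff; case: ifP => // ?; rewrite ifT //; lia.
  have hb : (b < (a + b).+1)%N by lia.
  rewrite (bigD1 (Ordinal hb)) //= ltnn (_ : 2 * b <= a)%N // addnK mulr1n.
  rewrite big1 ?addr0 // => c /eqP/val_eqP /= cb.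
  case: ifP => // ?; rewrite ?mulr0n //; rewrite ifT; last by lia.
  by rewrite bin_small ?mulr0n //; lia.
rewrite /= F2 F1 -big_split /=.
rewrite addnS; under [RHS]eq_bigr do rewrite mulrnDl.
rewrite [RHS]big_split /= [X in _ = X + _]big_ord_recr /=.
rewrite [X in _ = (_ + X) + _](_ : _ = 0) ?addr0; last first.
  by rewrite /adem_coeff ifF ?mulr0n //; lia.
rewrite [X in _ = _ + X]big_ord_recl /= mul0rn add0r -big_split /=.
apply: eq_bigr => c _; rewrite /bump /= add1n.
rewrite (_ : ((a + b).+1 - c = (a + b - c).+1)%N) /=; last by have := ltn_ord c; lia.
rewrite subSS -!mulrnDr mulrn_odd [RHS]mulrn_odd; congr (_ *+ nat_of_bool _).
rewrite /adem_coeff.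
move: (c : nat) (ltn_ord c) => {}c hc.
have [le_ca|] := leqP (2 * c) a; last first.
  by move=> ?; rewrite !ifF //; lia.
set k := (a - 2 * c)%N; have -> : (2 * c < a)%N = (0 < k)%N by rewrite /k; lia.
have -> : (2 * c.+1 <= a)%N = (1 < k)%N by rewrite /k; lia.
rewrite (_ : (a - 2 * c.+1 = k - 2)%N); last by rewrite /k; lia.
(* At [c = b] with [k = 1] the two sides are 2 and 0, so only their parities agree. *)
have [lt_cb|ge_cb] := ltnP c b; last first.
  have -> : c = b by lia.
  have : (k < 2)%N by rewrite /k; lia.
  by move: k => [|[|k]] // _; rewrite (_ : b.+1 - b - 1 = 0)%N ?subnn //; lia.
have [n ->] : exists n, b = (c + n).+1 by exists (b - c.+1)%N; lia.
rewrite (_ : (c + n).+1 - c - 1 = n)%N; last by lia.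
rewrite (_ : (c + n).+1 - c = n.+1)%N; last by lia.
rewrite (_ : (c + n).+2 - c - 1 = n.+1)%N; last by lia.
(* For [k >= 2], Pascal's rule turns both sides into C(n,k) + C(n,k-1) + C(n,k-2). *)
congr odd; move: k => [|[|k]] //=; rewrite ?subn1 ?subn0 ?bin0 ?bin1 //=; try lia.
by rewrite subn2 /= !binS; lia.
Qed.

End AdemShift.

(* [T] is a total square: the coefficient of ['X^i] in [T y] is Sq^i y. *)
Record square_model (P : comNzRingType) (T : {rmorphism P -> {poly P}}) : Prop :=
  SquareModel {
    model_pchar : forall x : P, x *+ 2 = 0;
    model_op0 : forall y, (T y)`_0 = y;
    model_adem : forall y, adem_holds (fun a b => (T (T y)`_b)`_a) }.

Lemma square_model_F2 : square_model (polyC : {rmorphism 'F_2 -> {poly 'F_2}}).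
Proof.
split=> [x|y|y a b ab]; last have [->|a0] := posnP a.
- by rewrite -[x *+ 2]mulr_natl (_ : 2%:R = 0) ?mul0r //; exact: val_inj.
- by rewrite coefC.
- rewrite big_ord_recl big1 /=; last first.
    by move=> c _; rewrite /adem_coeff /bump /= mulr0n.
  rewrite /adem_coeff /= bin0 addr0 add0n subn0 !coefC.
  by case: eqP => //= _; rewrite coefC; case: eqP.
rewrite coefC -[a == 0%N]negbK -lt0n a0 big1 //= => c _.
rewrite [(polyC y)`_c]coefC coefC /adem_coeff; case: leqP => ?; rewrite ?mulr0n //.
by rewrite ifF ?mul0rn //; lia.
Qed.

(** * Adjoining a variable of degree 1 *)

Section SquareModelStep.
Variables (P : comNzRingType) (T : {rmorphism P -> {poly P}}).
Hypothesis model : square_model T.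

Definition square_lift : {rmorphism P -> {poly {poly P}}} := map_poly polyC \o T.

Lemma square_lift_comm : commr_rmorph square_lift ('X%:P + 'X%:P ^+ 2 * 'X).
Proof. by move=> x; exact: mulrC. Qed.

(** The inner variable ['X%:P] is the new class X, and the outer ['X], written t below, records the
    degree of the operation; thus X goes to its total square X + X^2 t. *)
Definition square_step : {rmorphism {poly P} -> {poly {poly P}}} :=
  horner_morph square_lift_comm.

Lemma square_step_coefC i c : (square_step c%:P)`_i = ((T c)`_i)%:P.
Proof. by rewrite /= horner_morphC coef_map. Qed.

Lemma poly_mulrn2 (p : {poly P}) : p *+ 2 = 0.
Proof. by apply/polyP => i; rewrite coefMn coef0 (model_pchar model). Qed.

Lemma square_stepX : square_step 'X = 'X%:P + 'X%:P ^+ 2 * 'X.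
Proof. exact: horner_morphX. Qed.

Lemma square_step_coefMX i p : (square_step (p * 'X))`_i =
  'X * (square_step p)`_i + 'X ^+ 2 * (if i is j.+1 then (square_step p)`_j else 0).
Proof.
rewrite rmorphM square_stepX mulrDr coefD mulrC coefCM; congr (_ + _).
rewrite mulrA [_ * 'X%:P ^+ 2]mulrC -mulrA -polyC_exp coefCM coefMX.
by case: i.
Qed.

Lemma square_step_op0 p : (square_step p)`_0 = p.
Proof.
elim/poly_ind: p => [|p c IH]; first by rewrite rmorph0 coef0.
rewrite rmorphD coefD square_step_coefC (model_op0 model) square_step_coefMX IH.
by rewrite mulr0 addr0 mulrC.
Qed.

(** The total square of X^2 is (X + X^2 t)^2 = X^2 + X^4 t^2, since the cross terms cancel in
    characteristic 2. *)
Lemma square_step_coefMX2 i p : (square_step (p * 'X ^+ 2))`_i =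
  'X ^+ 2 * (square_step p)`_i
  + 'X ^+ 4 * (if i is j.+2 then (square_step p)`_j else 0).
Proof.
rewrite (_ : p * 'X ^+ 2 = p * 'X * 'X) ?mulrA // square_step_coefMX.
case: i => [|i]; rewrite !square_step_coefMX.
  by rewrite !mulr0 !addr0 mulrA expr2.
rewrite !mulrDr !mulrA -!expr2 -!exprSr.
by rewrite addrA -[X in X + _]addrA -mulr2n poly_mulrn2 addr0.
Qed.

Let op2 p a b := (square_step (square_step p)`_b)`_a.

Lemma square_step_op2MX p a b : op2 (p * 'X) a b =
  'X * op2 p a b
  + 'X ^+ 2 * (adem_shift1 (op2 p) a b + adem_shift2 (op2 p) a b)
  + 'X ^+ 4 * adem_shift3 (op2 p) a b.
Proof.
rewrite {1}/op2 square_step_coefMX rmorphD coefD [_ * (square_step p)`_b]mulrC.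
rewrite ['X ^+ 2 * _]mulrC square_step_coefMX square_step_coefMX2 mulrDr !addrA.
congr (_ + _ + _ * _ + _ * _); first by case: b => //; rewrite rmorph0 coef0.
by case: a => [|[|a]] //; case: b => //; rewrite rmorph0 coef0.
Qed.

Lemma square_step_op2D p c a b :
  op2 (p + c%:P) a b = op2 p a b + ((T (T c)`_b)`_a)%:P.
Proof. by rewrite /op2 rmorphD coefD rmorphD coefD !square_step_coefC. Qed.

(** Horner induction on the polynomial: constants are handled by the model [T], multiplication by X
    by the shift lemmas applied to the induction hypothesis. *)
Lemma square_model_step : square_model square_step.
Proof.
split=> [||p]; [exact: poly_mulrn2 | exact: square_step_op0 |].
rewrite -/(op2 p).
elim/poly_ind: p => [|p c IH] a b ab.
  by rewrite /op2 !(rmorph0, coef0) big1 // => c _; rewrite !(rmorph0, coef0) mul0rn.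
rewrite square_step_op2D (model_adem model) // square_step_op2MX.
rewrite IH // (adem_holds_shift12 poly_mulrn2 IH) // (adem_holds_shift3 IH) //.
rewrite !mulr_sumr raddf_sum -!big_split; apply: eq_bigr => i _ /=.
rewrite square_step_op2D square_step_op2MX raddfMn.
by rewrite !mulrnDl -!mulrnAr !mulrnDl.
Qed.
End SquareModelStep.

(** * Detecting admissible sequences *)

Fixpoint op_seq (P : comNzRingType) (T : {rmorphism P -> {poly P}}) (I : seq nat) y :=
  if I is i :: I' then (T (op_seq T I' y))`_i else y.

Definition wadm (I : seq nat) : bool := sorted (fun i j => 2 * j <= i)%N I.
Arguments wadm I : simpl never.

(* Zero entries are allowed, so that sequences of different lengths can be
   compared after padding to a common length [m]. *)
Definition detects_admissibles (P : comNzRingType) (T : {rmorphism P -> {poly P}})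
    (w : P) (n : nat) : Prop :=
  forall m (s : seq (seq nat)), uniq s ->
    (forall I, I \in s -> [/\ wadm I, size I = m & (sumn I <= n)%N]) ->
    \sum_(I <- s) op_seq T I w = 0 -> s = [::].

(* The coefficient of the highest possible power [2 ^ size I] of the new variable
   in Sq^I (w X), by the Cartan formula. *)
Fixpoint top_op (P : comNzRingType) (T : {rmorphism P -> {poly P}}) (I : seq nat) y :=
  if I is i :: I' then
    if (2 ^ size I' <= i)%N then (T (top_op T I' y))`_(i - 2 ^ size I') else 0
  else y.

Section Detect.
Variables (P : comNzRingType) (T : {rmorphism P -> {poly P}}).
Variable T' : {rmorphism {poly P} -> {poly {poly P}}}.
Hypothesis model : square_model T.
Hypothesis T'C : forall i c, (T' c%:P)`_i = ((T c)`_i)%:P.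
Hypothesis T'X : T' 'X = 'X%:P + 'X%:P ^+ 2 * 'X.

(** By Frobenius the total square of X^(2^k) is X^(2^k) + X^(2^(k+1)) t^(2^k). *)
Lemma square_coefMXpow2 k i c : (T' (c%:P * 'X ^+ (2 ^ k)))`_i =
  ((T c)`_i)%:P * 'X ^+ (2 ^ k) +
  (if (2 ^ k <= i)%N then (T c)`_(i - 2 ^ k) else 0)%:P * 'X ^+ (2 ^ k.+1).
Proof.
rewrite rmorphM rmorphXn T'X.
have -> : ('X%:P + 'X%:P ^+ 2 * 'X : {poly {poly P}}) ^+ (2 ^ k)
   = ('X ^+ (2 ^ k))%:P + ('X ^+ (2 ^ k.+1))%:P * 'X ^+ (2 ^ k).
  elim: k => [|k IH]; first by rewrite expn0 !expr1 expn1 polyC_exp.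
  rewrite expnSr exprM IH sqrrD.
  have P2 (x : {poly {poly P}}) : x *+ 2 = 0.
    by apply/polyP => j; rewrite coefMn coef0 (poly_mulrn2 model).
  by rewrite P2 addr0 exprMn -!polyC_exp -!exprM -!expnSr.
rewrite mulrDr coefD mulrC coefCM T'C mulrC; congr (_ + _).
rewrite mulrCA coefCM mulrC coefMXn T'C ltnNge.
by case: leqP.
Qed.

(** Each operation keeps or doubles the exponent of a power X^(2^k); the largest exponent arises
    only by doubling every time, and its coefficient is [top_op]. *)
Lemma op_seq_MX I w : exists g : nat -> P, g (size I) = top_op T I w /\
  op_seq T' I (w%:P * 'X) = \sum_(k < (size I).+1) (g k)%:P * 'X ^+ (2 ^ k).
Proof.
elim: I => [|i I [g [g_top g_sum]]] /=.
  by exists (fun=> w); split=> //; rewrite big_ord1 expn0 expr1.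
exists (fun k => (if (k <= size I)%N then (T (g k))`_i else 0) +
  if k is k'.+1 then if (2 ^ k' <= i)%N then (T (g k'))`_(i - 2 ^ k') else 0 else 0).
split; first by rewrite ltnn add0r g_top.
rewrite g_sum rmorph_sum coef_sum.
under [LHS]eq_bigr do rewrite square_coefMXpow2.
under [RHS]eq_bigr do rewrite polyCD mulrDl.
rewrite !big_split /= [X in _ = X + _]big_ord_recr /= ltnn polyC0 mul0r addr0.
rewrite [X in _ = _ + X]big_ord_recl /= polyC0 mul0r add0r.
by congr (_ + _); apply: eq_bigr => k _; rewrite -ltnS ltn_ord.
Qed.

Lemma coef_op_seq_MX I w : (op_seq T' I (w%:P * 'X))`_(2 ^ size I) = top_op T I w.
Proof.
have [g [<- ->]] := op_seq_MX I w.
rewrite coef_sum big_ord_recr /= coefCM coefXn eqxx mulr1 big1 ?add0r // => k _.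
by rewrite coefCM coefXn eqn_exp2l // gtn_eqF ?mulr0.
Qed.
End Detect.

(** * Lowering admissible sequences by powers of 2 *)

Fixpoint pred_pow2 (I : seq nat) : seq nat :=
  if I is i :: I' then (i - 2 ^ size I')%N :: pred_pow2 I' else [::].

Lemma size_pred_pow2 I : size (pred_pow2 I) = size I.
Proof. by elim: I => //= i I ->. Qed.

Lemma wadm_cons i I : wadm (i :: I) = (2 * head 0%N I <= i)%N && wadm I.
Proof. by case: I. Qed.

Lemma wadm_pow2 i I : wadm (i :: I) -> last i I != 0%N -> (2 ^ size I <= i)%N.
Proof.
elim: I i => [|j I IH] i; rewrite wadm_cons /=; first by rewrite expn0 lt0n.
by move=> /andP[le_ji /IH {}IH] /IH; rewrite expnS; lia.
Qed.

Lemma wadm_pred_pow2 I : wadm I -> wadm (pred_pow2 I).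
Proof.
elim: I => // i [|j I] // IH; rewrite wadm_cons => /andP[/= le_ji /IH {}IH].
by rewrite wadm_cons /= IH expnS andbT; lia.
Qed.

Lemma pred_pow2_inj I J : size I = size J -> wadm I -> wadm J ->
  last 1%N I != 0%N -> last 1%N J != 0%N -> pred_pow2 I = pred_pow2 J -> I = J.
Proof.
elim: I J => [|i I IH] [|j J] //= [eqs] wI wJ lI lJ.
have := wadm_pow2 wI lI; have := wadm_pow2 wJ lJ; rewrite -eqs => hj hi [hij hIJ].
congr (_ :: _); first by lia.
move: wI wJ; rewrite !wadm_cons => /andP[_ wI] /andP[_ wJ].
by apply: IH => //; [case: (I) lI | case: (J) lJ].
Qed.

Lemma sumn_pred_pow2 I : wadm I -> last 0%N I != 0%N ->
  (sumn (pred_pow2 I) < sumn I)%N.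
Proof.
elim: I => // i [|j I] IH wI lI.
  by have := wadm_pow2 wI lI; rewrite /= expn0; lia.
have := wadm_pow2 wI lI; move: wI; rewrite wadm_cons => /andP[_ /IH/(_ lI)].
by move=> h /=; move: h => /=; lia.
Qed.

(** Every guard in [top_op] holds, because an entry with j successors is at least 2^j by
    [wadm_pow2]. *)
Lemma top_op_pred_pow2 (P : comNzRingType) (T : {rmorphism P -> {poly P}}) I w :
  wadm I -> last 1%N I != 0%N -> top_op T I w = op_seq T (pred_pow2 I) w.
Proof.
elim: I => // i I IH wI lI /=; rewrite (wadm_pow2 wI lI) IH //.
  by move: wI; rewrite wadm_cons => /andP[].
by case: (I) lI.
Qed.

Lemma top_op_last0 (P : comNzRingType) (T : {rmorphism P -> {poly P}}) I w :
  last 1%N I = 0%N -> top_op T I w = 0.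
Proof.
elim: I => // i [|j I] IH lI; first by rewrite /= (lI : i = 0%N).
by have /= -> := IH lI; rewrite rmorph0 coef0; case: ifP.
Qed.

Lemma uniq_sum_nil (T : eqType) (V : zmodType) (f : T -> V) (x : T) (s : seq T) :
  uniq s -> (forall y, y \in s -> y = x) -> f x != 0 ->
  \sum_(y <- s) f y = 0 -> s = [::].
Proof.
case: s => // y [|z s] us sx fx0.
  have -> := sx y (mem_head _ _).
  by rewrite big_seq1 => /eqP; rewrite (negbTE fx0).
have ey : y = x by apply: sx; rewrite mem_head.
have ez : z = x by apply: sx; rewrite !inE eqxx orbT.
by move: us; rewrite /= inE ey ez eqxx.
Qed.

Lemma mulX_neq0 (R : nzRingType) (c : R) : c != 0 -> c%:P * 'X != 0.
Proof.
move=> c0; apply/eqP => /(congr1 (fun p : {poly R} => p`_1)).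
by rewrite coefMX coefC coef0 /=; apply/eqP.
Qed.

Lemma detects_step (P : comNzRingType) (T : {rmorphism P -> {poly P}})
    (T' : {rmorphism {poly P} -> {poly {poly P}}}) w n :
  square_model T ->
  (forall i c, (T' c%:P)`_i = ((T c)`_i)%:P) ->
  T' 'X = 'X%:P + 'X%:P ^+ 2 * 'X -> (forall y, (T' y)`_0 = y) -> w != 0 ->
  detects_admissibles T w n -> detects_admissibles T' (w%:P * 'X) n.+1.
Proof.
move=> model T'C T'X T'0 w0 det; elim=> [|m IHm] s us sP sum0.
  apply: (uniq_sum_nil (x := [::])) us _ _ sum0 => [I /sP[_ /size0nil]|] //=.
  exact: mulX_neq0.
have h0 : \sum_(I <- [seq I <- s | last 0%N I != 0%N]) op_seq T (pred_pow2 I) w = 0.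
  have := congr1 (fun p : {poly P} => p`_(2 ^ m.+1)) sum0.
  rewrite coef_sum coef0 => e0; rewrite -[RHS]e0 big_filter big_mkcond /=.
  apply: eq_big_seq => I /sP[wI sI _].
  rewrite -sI (coef_op_seq_MX model) //; case: I sI wI => // i I sI wI.
  case: eqP => l0; first by rewrite top_op_last0.
  by rewrite top_op_pred_pow2 //; exact/eqP.
have s'0 : map pred_pow2 [seq I <- s | last 0%N I != 0%N] = [::].
  apply: (det m.+1); last by rewrite big_map.
    rewrite map_inj_in_uniq ?filter_uniq // => I J; rewrite !mem_filter.
    move=> /andP[lI /sP[wI sI _]] /andP[lJ /sP[wJ sJ _]].
    apply: pred_pow2_inj => //; rewrite ?sI //.
      by case: (I) sI lI.
    by case: (J) sJ lJ.
  move=> _ /mapP[I + ->]; rewrite mem_filter => /andP[lI /sP[wI sI dI]].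
  split; [exact: wadm_pred_pow2 | by rewrite size_pred_pow2 |].
  by rewrite -ltnS; apply: leq_trans dI; exact: sumn_pred_pow2.
have last0 I : I \in s -> last 0%N I = 0%N.
  move=> Is; apply/eqP; apply/negPn/negP => lI.
  have /eqP := congr1 size s'0; rewrite size_map size_eq0 => /eqP s0.
  by have := mem_filter (fun I => last 0%N I != 0%N) I s; rewrite s0 lI Is.
have s_belast I : I \in s -> exists2 J, size J = m & I = rcons J 0%N.
  move=> Is; have [_ sI _] := sP _ Is; have := last0 _ Is.
  case/lastP: I Is sI => // I i _; rewrite size_rcons last_rcons => -[sI] ->.
  by exists I.
have take_rcons (J : seq nat) i : size J = m -> take m (rcons J i) = J.
  by move=> <-; rewrite -cats1 take_size_cat.
have /(congr1 size) : map (take m) s = [::]; last by case: (s).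
apply: IHm.
- rewrite map_inj_in_uniq // => I J /s_belast[I' sI ->] /s_belast[J' sJ ->].
  by rewrite !take_rcons // => ->.
- move=> _ /mapP[I Is ->]; have [J sJ eI] := s_belast _ Is.
  have := sP _ Is; rewrite eI take_rcons // => -[wJ _].
  rewrite sumn_rcons addn0 => dJ; split=> //.
  by move: wJ; rewrite /wadm -cats1 => /cat_sorted2[].
rewrite big_map -[RHS]sum0; apply: eq_big_seq => I /s_belast[J sJ ->].
rewrite take_rcons //; elim: J {sJ} => /= [|j J -> //].
by rewrite T'0.
Qed.

Lemma admissibles_detected n : exists (P : comNzRingType)
    (T : {rmorphism P -> {poly P}}) (w : P),
  [/\ square_model T, w != 0 & detects_admissibles T w n].
Proof.
elim: n => [|n [P [T [w [model w0 det]]]]]; last first.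
  exists {poly P}, (square_step T), (w%:P * 'X); split.
  - exact: square_model_step.
  - exact: mulX_neq0.
  - apply: (detects_step model _ _ _ w0 det).
    + exact: square_step_coefC.
    + exact: square_stepX.
    + exact: square_step_op0.
exists 'F_2, polyC, 1; split; [exact: square_model_F2 | by rewrite oner_eq0 |].
move=> m s us sP.
apply: (uniq_sum_nil (f := fun I => op_seq polyC I 1) (x := nseq m 0%N)) us _ _ => [I|].
  case/sP=> _ <-; rewrite leqn0; elim: I => //= i I IH.
  by rewrite addn_eq0 => /andP[/eqP-> /IH {1}->].
suff -> : op_seq polyC (nseq m 0%N) 1 = 1 :> 'F_2 by rewrite oner_eq0.
by elim: m {sP} => //= m ->; rewrite coefC.
Qed.

(** * Linear independence of the admissible monomials *)

Section Action.
Variables (P : comNzRingType) (T : {rmorphism P -> {poly P}}).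
Hypothesis model : square_model T.

Definition F2_embed (c : 'F_2) : P := (c : nat)%:R.

Lemma F2_embed_zmod : zmod_morphism F2_embed.
Proof.
have P1 : 1 = - 1 :> P.
  by apply/eqP; rewrite -addr_eq0; apply/eqP; exact: model_pchar model 1.
by move=> [[|[|//]] i] [[|[|//]] j]; rewrite /F2_embed /= ?subrr ?subr0 ?sub0r // -P1.
Qed.
HB.instance Definition _ := GRing.isZmodMorphism.Build 'F_2 P F2_embed F2_embed_zmod.

Lemma F2_embedM c d : F2_embed (c * d) = F2_embed c * F2_embed d.
Proof.
by case: c => [[|[|//]] i]; case: d => [[|[|//]] j];
  rewrite /F2_embed /= ?mulr0 ?mul0r ?mulr1.
Qed.

Lemma op_seq_sum I (J : Type) (r : seq J) (F : J -> P) :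
  op_seq T I (\sum_(j <- r) F j) = \sum_(j <- r) op_seq T I (F j).
Proof. by elim: I => //= i I ->; rewrite rmorph_sum coef_sum. Qed.

Lemma op_seqZ I c y : op_seq T I (F2_embed c * y) = F2_embed c * op_seq T I y.
Proof.
by rewrite /F2_embed !mulr_natl; elim: I => //= i I ->; rewrite rmorphMn coefMn.
Qed.

Lemma op_seq_cat I J y : op_seq T (I ++ J) y = op_seq T I (op_seq T J y).
Proof. by elim: I => //= i I ->. Qed.

Definition act (f : free_steenrod) (y : P) : P :=
  mmap F2_embed (fun w : {fmonom nat} => op_seq T w y) f.

Lemma actM f g y : act (f * g) y = act f (act g y).
Proof.
rewrite malgME /act !raddf_sum [in RHS]mmapE.
apply: eq_bigr => k1 _; rewrite raddf_sum mmapE op_seq_sum mulr_sumr.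
apply: eq_bigr => k2 _.
by rewrite [LHS]mmapU /= F2_embedM fmM op_seq_cat op_seqZ mulrA.
Qed.

Lemma act0 f : act f 0 = 0.
Proof.
rewrite /act mmapE big1 // => w _.
suff -> : op_seq T w 0 = 0 by rewrite mulr0.
by elim: (w : seq nat) => //= i I ->; rewrite rmorph0 coef0.
Qed.

Lemma act0l y : act 0 y = 0.
Proof. exact: mmap0. Qed.

Lemma actB f g y : act (f - g) y = act f y - act g y.
Proof. exact: mmapB. Qed.

Lemma act_sum (J : Type) (r : seq J) (F : J -> free_steenrod) y :
  act (\sum_(j <- r) F j) y = \sum_(j <- r) act (F j) y.
Proof. exact: raddf_sum. Qed.

Lemma actU w y : act << w >> y = op_seq T w y.
Proof. by rewrite /act mmapU mul1r. Qed.

Lemma act1 y : act 1 y = y.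
Proof. by have := actU mone y; rewrite fm1. Qed.

Lemma act_Sq i y : act (free_Sq i) y = (T y)`_i.
Proof. by rewrite actU fmU. Qed.

Lemma act_natZ n f y : act (n%:R *: f) y = act f y *+ n.
Proof. by rewrite scaler_nat /act raddfMn. Qed.

Lemma act_relation r y : steenrod_relation r -> act r y = 0.
Proof.
case=> [|a b /andP[a_gt0 a_lt]].
  by rewrite actB act1 act_Sq (model_op0 model) subrr.
rewrite /adem actB actM !act_Sq (model_adem model) // act_sum.
have le_ab : (a./2.+1 <= (a + b).+1)%N by rewrite ltnS; lia.
apply/eqP; rewrite subr_eq0; apply/eqP.
rewrite -(subnKC le_ab) big_split_ord /= [X in _ + X]big1 ?addr0 => [|c _].
  apply: eq_bigr => c _; rewrite act_natZ actM !act_Sq /adem_coeff ifT //.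
  by have := ltn_ord c; lia.
by rewrite /adem_coeff ifF ?mulr0n //=; lia.
Qed.

Lemma act_ideal f y : f \in steenrod_ideal -> act f y = 0.
Proof.
case/two_sided_idealP => s sR ->; rewrite act_sum big_seq big1 // => t /sR tR.
by rewrite !actM (act_relation _ tR) act0.
Qed.

Lemma pi_eq_act f g y : \pi_steenrod f = \pi_steenrod g -> act f y = act g y.
Proof.
move/eqP; rewrite steenrod_piE => /(act_ideal y); rewrite actB => /eqP.
by rewrite subr_eq0 => /eqP.
Qed.
End Action.

Definition free_SqI (I : seq nat) : free_steenrod := \prod_(i <- I) free_Sq i.

Lemma pi_free_SqI I : \pi_steenrod (free_SqI I) = SqI I.
Proof.
rewrite /free_SqI /SqI; elim: I => [|i I IH]; first by rewrite !big_nil.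
by rewrite !big_cons steenrod_piM IH.
Qed.

Lemma act_SqI (P : comNzRingType) (T : {rmorphism P -> {poly P}}) I y :
  square_model T -> act T (free_SqI I) y = op_seq T I y.
Proof.
move=> model; rewrite /free_SqI; elim: I => [|i I IH] /=.
  by rewrite big_nil act1.
by rewrite big_cons actM // IH act_Sq.
Qed.

(** Over F_2 a list encodes a linear combination; repeated sequences cancel in pairs. *)
Definition SqSum (s : seq (seq nat)) : steenrod := \sum_(I <- s) SqI I.

Lemma admissible_wadm I : admissible I = wadm I && all (ltn 0) I.
Proof. by rewrite andbC. Qed.

Lemma wadm_pad I k : wadm I -> wadm (I ++ nseq k 0%N).
Proof.
elim: I => [|i I IH]; first by elim: k => // -[|k].
rewrite cat_cons !wadm_cons => /andP[hd /IH ->]; rewrite andbT.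
by case: I hd {IH}; case: k.
Qed.

Lemma steenrod_pi0 : \pi_steenrod 0 = 0 :> steenrod.
Proof. by apply: (addrI (\pi_steenrod 0)); rewrite -steenrod_piD !addr0. Qed.

(** Detection compares sequences of one length, so zeros are appended up to the maximal length. This
    is injective because admissible sequences have positive entries. *)
Lemma SqSum_free s : uniq s -> (forall I, I \in s -> admissible I) ->
  SqSum s = 0 -> s = [::].
Proof.
move=> us sA s0.
pose n := \max_(I <- s) sumn I; pose m := \max_(I <- s) size I.
have [P [T [w [model w0 det]]]] := admissibles_detected n.
pose pad I := I ++ nseq (m - size I) 0%N.
have op_pad I : op_seq T (pad I) w = op_seq T I w.
  rewrite op_seq_cat; congr op_seq; elim: (m - _)%N => //= k ->.
  exact: model_op0.
have filter_pad I : I \in s -> filter (ltn 0) (pad I) = I.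
  move/sA; rewrite admissible_wadm filter_cat => /andP[_ /all_filterP ->].
  by rewrite filter_nseq cats0.
suff /(congr1 size) : map pad s = [::] by case: (s).
apply: (det m).
- rewrite map_inj_in_uniq // => I J /filter_pad {2}<- /filter_pad {2}<- -> //.
- move=> _ /mapP[I Is ->]; have := sA _ Is; rewrite admissible_wadm => /andP[wI pI].
  split; last by rewrite sumn_cat sumn_nseq mul0n addn0 /n (big_rem I) //= leq_maxl.
    exact: wadm_pad.
  by rewrite size_cat size_nseq subnKC // /m (big_rem I) //= leq_maxl.
rewrite big_map; under eq_bigr do rewrite op_pad -act_SqI //.
rewrite -act_sum // -[RHS](act0l model w); apply: pi_eq_act => //.
rewrite steenrod_pi0 (big_morph _ steenrod_piD steenrod_pi0) -[RHS]s0.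
by apply: eq_bigr => I _; exact: pi_free_SqI.
Qed.

(** * Reduction to admissible monomials *)

Lemma steenrod_addxx (x : steenrod) : x + x = 0.
Proof.
by rewrite -{1 2}[x]scale1r -scalerDl (_ : 1 + 1 = 0) ?scale0r //; exact: val_inj.
Qed.

Lemma steenrod_opp (x : steenrod) : - x = x.
Proof. by apply/eqP; rewrite eq_sym -addr_eq0 steenrod_addxx. Qed.

Lemma relation_ideal r : steenrod_relation r -> r \in steenrod_ideal.
Proof.
move=> r_rel; apply/two_sided_idealP; exists [:: (1, r, 1)].
  by move=> t; rewrite inE => /eqP ->.
by rewrite big_seq1 mul1r mulr1.
Qed.

Lemma Sq0 : Sq 0 = 1.
Proof.
apply/eqP; rewrite (_ : 1 = \pi_steenrod 1) // steenrod_piE.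
exact/relation_ideal/Sq0_relation.
Qed.

Lemma Sq_adem a b : (0 < a < 2 * b)%N ->
  Sq a * Sq b =
    \sum_(c < a./2.+1) (Sq (a + b - c) * Sq c) *+ 'C(b - c - 1, a - 2 * c).
Proof.
move=> hab; transitivity (\pi_steenrod (\sum_(c < a./2.+1)
    'C(b - c - 1, a - 2 * c)%:R *: (free_Sq (a + b - c) * free_Sq c))).
  rewrite -steenrod_piM; apply/eqP; rewrite steenrod_piE.
  exact/relation_ideal/adem_relation.
rewrite (big_morph _ steenrod_piD steenrod_pi0); apply: eq_bigr => c _.
by rewrite steenrod_piZ steenrod_piM scaler_nat.
Qed.

Lemma SqI_cons i I : SqI (i :: I) = Sq i * SqI I.
Proof. by rewrite /SqI big_cons. Qed.

Lemma SqI_nil : SqI [::] = 1.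
Proof. by rewrite /SqI big_nil. Qed.

Lemma SqI_cat I J : SqI (I ++ J) = SqI I * SqI J.
Proof. by rewrite /SqI big_cat. Qed.

Definition spans (P : seq nat -> Prop) (x : steenrod) : Prop :=
  exists2 s, (forall I, I \in s -> P I) & x = SqSum s.

Section Spans.
Implicit Types P Q : seq nat -> Prop.

Lemma spans0 P : spans P 0.
Proof. by exists [::] => //; rewrite /SqSum big_nil. Qed.

Lemma spans_SqI P I : P I -> spans P (SqI I).
Proof.
by exists [:: I]; rewrite /SqSum ?big_seq1 // => J; rewrite inE => /eqP ->.
Qed.

Lemma spansD P x y : spans P x -> spans P y -> spans P (x + y).
Proof.
move=> [s sP ->] [t tP ->]; exists (s ++ t); last by rewrite /SqSum big_cat.
by move=> I; rewrite mem_cat => /orP[/sP|/tP].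
Qed.

Lemma spans_sum P (J : Type) (r : seq J) (p : pred J) (F : J -> steenrod) :
  (forall j, p j -> spans P (F j)) -> spans P (\sum_(j <- r | p j) F j).
Proof. by move=> FP; apply: big_ind => // [|x y]; [exact: spans0 | exact: spansD]. Qed.

Lemma spans_mull P Q a x : (forall I, P I -> spans Q (a * SqI I)) ->
  spans P x -> spans Q (a * x).
Proof.
move=> PQ [s sP ->]; rewrite /SqSum mulr_sumr big_seq.
by apply: spans_sum => I /sP /PQ.
Qed.

Lemma spansS P Q x : (forall I, P I -> Q I) -> spans P x -> spans Q x.
Proof. by move=> PQ [s sP ->]; exists s => // I /sP /PQ. Qed.

Lemma spansMn P x n : spans P x -> spans P (x *+ n).
Proof.
by move=> xP; elim: n => [|n IH]; rewrite ?mulr0n ?mulrS; [exact: spans0|exact: spansD].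
Qed.
End Spans.

Lemma admissible_cons i I :
  admissible (i :: I) = [&& (0 < i)%N, (2 * head 0%N I <= i)%N & admissible I].
Proof. by rewrite !admissible_wadm wadm_cons /= -!andbA; do !bool_congr. Qed.

Definition adm_below d h (K : seq nat) : Prop :=
  [/\ admissible K, sumn K = d & (head 0 K <= h)%N].

(** Outer induction on the total degree, inner induction on the degree of [J]. In an Adem term, Sq^c
    times the tail of [J] has smaller total degree; its admissible form then has smaller degree than
    [J], as c is less than the head of [J]. *)
Lemma Sq_mul_admissible a J : admissible J ->
  spans (adm_below (a + sumn J) (maxn a (2 * head 0%N J - 1))) (Sq a * SqI J).
Proof.
have [d] := ubnP (a + sumn J); elim: d => // d IHd in a J *.
have [k] := ubnP (a + sumn J - a); elim: k => // k IHk in a J *.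
move=> lek led admJ; have [a0|a_gt0] := posnP a.
  rewrite a0 Sq0 mul1r; apply: spans_SqI; split=> //; lia.
case: J => [|b J] in lek led admJ *.
  by rewrite -SqI_cons; apply: spans_SqI; split; rewrite ?admissible_cons /=; lia.
have [le_ba|lt_ab] := leqP (2 * b) a.
  rewrite -SqI_cons; apply: spans_SqI; split=> //=; last by lia.
  by rewrite admissible_cons a_gt0 le_ba.
rewrite SqI_cons mulrA Sq_adem ?a_gt0 // mulr_suml; apply: spans_sum => c _.
rewrite mulrnAl; have lec := ltn_ord c.
(* A nonzero coefficient forces [a + b - c <= 2 * b - 1], whence the bound on the head. *)
have [lt_bin|le_bin] := ltnP (b - c - 1) (a - 2 * c).
  by rewrite bin_small // mulr0n; exact: spans0.
move: admJ; rewrite admissible_cons => /and3P[b_gt0 hJ admJ].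
apply: spansMn; rewrite -mulrA.
apply: spans_mull (IHd c J _ admJ); last by rewrite /= in led; lia.
move=> L [admL sumL headL]; rewrite /= in lek led *.
apply: spansS (IHk (a + b - c)%N L _ _ admL); [|lia|lia].
by move=> K [admK sumK headK]; split=> //; lia.
Qed.

(** * Lexicographic order and leading terms *)

Fixpoint lexlt (s t : seq nat) : bool :=
  match s, t with
  | _, [::] => false
  | [::], _ :: _ => true
  | i :: s', j :: t' => (i < j)%N || (i == j) && lexlt s' t'
  end.

Definition lower (I K : seq nat) : Prop :=
  [/\ admissible K, sumn K = sumn I & lexlt K I].

Lemma lexlt_head K I : lexlt K I -> (head 0%N K <= head 0%N I)%N.
Proof. by case: K I => [|k K] [|i I] //= /orP[/ltnW //|/andP[/eqP -> _]]. Qed.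

Lemma lower_cons i I K : admissible (i :: I) -> lower I K -> lower (i :: I) (i :: K).
Proof.
rewrite admissible_cons => /and3P[i_gt0 hI _] [admK sumK ltK].
split; last by rewrite /= eqxx ltK orbT.
  by rewrite admissible_cons i_gt0 admK andbT; have := lexlt_head ltK; lia.
by rewrite /= sumK.
Qed.

(* Inverts the Adem steps
   Sq^i Sq^(2^n + 1) = Sq^(2^(n+1) + 1) Sq^(i - 2^n) + smaller terms,
   started at Sq^3; a missing entry of [K] counts as [0]. *)
Fixpoint unwind (n : nat) (K : seq nat) : seq nat :=
  if n is n'.+1 then (head 0 K + 2 ^ n)%N :: unwind n' (behead K) else [::].

Lemma adm_below_lower d h i I x : d = sumn (i :: I) -> (h < i)%N ->
  spans (adm_below d h) x -> spans (lower (i :: I)) x.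
Proof.
move=> -> lt_hi; apply: spansS => K [admK sumK hK]; split=> //.
by case: K hK {admK sumK} => //= k K hK; rewrite (leq_ltn_trans hK).
Qed.

(** The Adem term [c = k] has coefficient 1. Nonzero coefficients force [c >= k], so all other terms
    start with a square of degree at most 2^(n+2); the bound on [head 0 L] preserves this under
    reduction to admissible form. *)
Lemma Sq_mul_pow2 n k L : (k <= 2 ^ n.+1)%N -> (head 0 L <= 2 ^ n)%N -> admissible L ->
  exists2 y, spans (adm_below (k + 2 ^ n.+2 + 1 + sumn L) (2 ^ n.+2)) y &
   Sq (k + 2 ^ n.+1) * SqI ((2 ^ n.+1 + 1)%N :: L) =
   Sq (2 ^ n.+2 + 1) * (Sq k * SqI L) + y.
Proof.
rewrite !expnS => lek hL admL; set q := (2 ^ n)%N in lek hL *.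
have q_gt0 : (0 < q)%N by rewrite expn_gt0.
rewrite SqI_cons mulrA Sq_adem; last by lia.
have ltk : (k < (k + 2 * q)./2.+1)%N by lia.
rewrite (bigD1 (Ordinal ltk)) //= mulrDl.
have -> : 'C(2 * q + 1 - k - 1, k + 2 * q - 2 * k) = 1%N.
  by rewrite (_ : k + 2 * q - 2 * k = 2 * q + 1 - k - 1)%N ?binn //; lia.
rewrite mulr1n (_ : k + 2 * q + (2 * q + 1) - k = 2 * (2 * q) + 1)%N; last by lia.
rewrite mulrA; eexists; last reflexivity.
rewrite mulr_suml; apply: spans_sum => c /eqP/val_eqP/= ck.
have lec := ltn_ord c; rewrite mulrnAl -mulrA.
have [lt_bin|le_bin] := ltnP (2 * q + 1 - c - 1) (k + 2 * q - 2 * c).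
  by rewrite bin_small // mulr0n; exact: spans0.
apply/spansMn/(spans_mull _ (Sq_mul_admissible c admL)) => M [admM sumM hM].
apply: spansS (Sq_mul_admissible _ admM) => N [admN sumN hN].
by split=> //; lia.
Qed.

Lemma Sq_unwind n K :
  admissible ((2 ^ n.+1 + 1)%N :: K) -> (2 <= last 2 K)%N ->
  exists2 y, spans (lower ((2 ^ n.+1 + 1)%N :: K)) y &
    SqI (unwind n K) * Sq 3 = SqI ((2 ^ n.+1 + 1)%N :: K) + y.
Proof.
elim: n K => [|n IH] K admK lastK.
  exists 0; first exact: spans0.
  (* The only entry that could follow 3 is a final 1, which [lastK] excludes. *)
  case: K admK lastK => [|k [|k' K]]; last 2 first.
  - by rewrite !admissible_cons /=; lia.
  - by rewrite !admissible_cons /=; lia.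
  by rewrite addr0 SqI_cons SqI_nil mul1r mulr1.
move: (admK); rewrite admissible_cons => /and3P[_ hK admK0].
have hK1 : (head 0 K <= 2 ^ n.+1)%N by move: hK; rewrite [(2 ^ n.+2)%N]expnS; lia.
have hK' : (2 * head 0 (behead K) <= head 0 K)%N.
  by case: (K) admK0 => // k K'; rewrite admissible_cons => /and3P[].
have admK' : admissible (behead K).
  by case: (K) admK0 => // k K'; rewrite admissible_cons => /and3P[].
have admB : admissible ((2 ^ n.+1 + 1)%N :: behead K).
  by rewrite admissible_cons admK' addn1 /=; lia.
have hK'1 : (head 0 (behead K) <= 2 ^ n)%N by move: hK1; rewrite expnS; lia.
have K0 : head 0%N K = 0%N -> K = [::].
  by case: (K) admK0 => // k K'; rewrite admissible_cons => /and3P[/= + _ _]; lia.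
have sumK : sumn K = (head 0 K + sumn (behead K))%N by case: (K).
have SqK : Sq (head 0%N K) * SqI (behead K) = SqI K.
  by case: (K) => [|k K'] /=; rewrite ?Sq0 ?mul1r // SqI_cons.
have [|y yP yE] := IH _ admB; first by case: (K) lastK => [|k [|]].
have [z zP zE] := Sq_mul_pow2 hK1 hK'1 admK'.
exists (z + Sq (head 0%N K + 2 ^ n.+1)%N * y).
  apply: spansD.
    by apply: adm_below_lower zP; rewrite /= ?sumK; lia.
  apply: spans_mull yP => L [admL sumL ltL].
  (* With a small head the product stays below 2^(n+2) + 1. Otherwise the head of [L] is 2^(n+1) + 1
     and its tail is below [behead K], so [Sq_mul_pow2] applies once more. *)
  have [small|] := leqP (head 0%N L) (2 ^ n.+1).
    apply: adm_below_lower (Sq_mul_admissible _ admL).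
      by rewrite sumL /= sumK [(2 ^ n.+2)%N]expnS; lia.
    by move: small hK1; rewrite [(2 ^ n.+2)%N]expnS; lia.
  case: L admL sumL ltL => [|l L] // admL sumL ltL /= big.
  move: ltL => /= /orP[|/andP[/eqP el ltL]]; first by move: big; lia.
  rewrite {}el in admL sumL *.
  move: admL; rewrite admissible_cons => /and3P[_ _ admL].
  have hL := lexlt_head ltL.
  have [|z' zP' zE'] := Sq_mul_pow2 hK1 _ admL; first exact: leq_trans hL _.
  rewrite zE'; apply: spansD; last first.
    apply: adm_below_lower zP'; last by lia.
    by move: sumL => /= ; rewrite sumK; lia.
  rewrite -!SqI_cons; apply: spans_SqI.
  have eK : K = head 0%N K :: behead K by case: (K) ltL; case: (L).
  have k_gt0 : (0 < head 0 K)%N by rewrite lt0n; apply/eqP => /K0 e; rewrite e in eK.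
  rewrite [in lower _]eK; apply: lower_cons; first by rewrite -eK.
  apply: lower_cons; first by rewrite -eK.
  by split=> //; move: sumL => /=; lia.
rewrite [unwind _ _]/= SqI_cons -mulrA yE mulrDr zE SqK -SqI_cons.
by rewrite -addrA.
Qed.

(* Entries 2^n + 1 with n >= 1; note that [trunc_log 2 2 = 1] excludes 2 = 2^0 + 1. *)
Definition special (i : nat) : bool := (i == 2 ^ trunc_log 2 i + 1)%N.

Lemma trunc_log_special n : trunc_log 2 (2 ^ n.+1 + 1) = n.+1.
Proof.
apply: trunc_log_eq => //; rewrite leq_addr /= [(2 ^ n.+2)%N]expnS.
by have := ltn_expl n.+1 (isT : (1 < 2)%N); lia.
Qed.

Lemma specialP i : reflect (exists n, i = 2 ^ n.+1 + 1)%N (special i).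
Proof.
apply: (iffP eqP) => [|[n ->]]; last by rewrite trunc_log_special.
case log_i: (trunc_log 2 i) => [|n] ei; last by exists n.
by have := trunc_log_eq0 2 i; rewrite log_i ei.
Qed.

Lemma avoids_special I : avoids_2n1 I <-> ~~ has special I.
Proof.
split=> [avI|].
  apply/hasPn => i iI; apply/negP => /specialP[n ei].
  exact: (avI i n.+1).
move/hasPn => nsI i [//|n] iI _ ei; have /negP[] := nsI _ iI.
by apply/specialP; exists n.
Qed.

(** The map from leading terms I to sequences J. Entries before the first special entry 2^(n+1) + 1
    are kept, and that entry with its tail is unwound in n steps; [.-1] turns the exponent into
    n. *)
Fixpoint rewind (I : seq nat) : seq nat :=
  if I is i :: I' then
    if special i then unwind (trunc_log 2 i).-1 I' else i :: rewind I'
  else [::].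

Lemma Sq_rewind I : admissible I -> (2 <= last 2 I)%N -> has special I ->
  exists2 y, spans (lower I) y & SqI (rewind I) * Sq 3 = SqI I + y.
Proof.
elim: I => //= i I IH admI lastI; have [/specialP[n ei] _|nsi /= hsI] := boolP (special i).
  rewrite {}ei trunc_log_special /= in admI *; apply: Sq_unwind => //.
  by case: (I) lastI.
have [_ _ admI'] := and3P (etrans (esym (admissible_cons i I)) admI).
have [|y yP yE] := IH admI' _ hsI; first by case: (I) hsI lastI.
exists (Sq i * y); last by rewrite !SqI_cons -mulrA yE mulrDr.
by apply: spans_mull yP => K lowK; rewrite -SqI_cons; apply/spans_SqI/lower_cons.
Qed.

(* The induction distinguishes whether all of [J] has to be unwound, in which case
   the next entry may still be absorbed, or the process stopped inside [J]. *)
Lemma rewind_onto J : admissible J -> (2 <= last 2 J)%N -> ~~ has special J ->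
  exists I, [/\ admissible I, (2 <= last 2 I)%N, has special I & rewind I = J].
Proof.
move=> admJ lastJ nsJ.
suff :
    (exists K, [/\ J = unwind (size J) K,
        admissible ((2 ^ (size J).+1 + 1)%N :: K) & (2 <= last 2 K)%N]) \/
    (exists I, [/\ admissible I, (2 <= last 2 I)%N, has special I, rewind I = J
        & head 0%N I = head 0%N J]).
  case=> [[K [eJ admK lastK]]|[I [aI lI sI eI _]]]; last by exists I; split.
  exists ((2 ^ (size J).+1 + 1)%N :: K).
  have spJ : special (2 ^ (size J).+1 + 1) by apply/specialP; exists (size J).
  split=> //=; last by rewrite spJ trunc_log_special /= -eJ.
    by case: (K) lastK => //= _; rewrite addn1 ltnS expn_gt0.
  by rewrite spJ.
elim: J admJ lastJ nsJ => [|j J IH]; first by left; exists [::].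
rewrite admissible_cons /= negb_or => /and3P[j_gt0 hJ admJ] lastJ /andP[nsj nsJ].
have lastJ' : (2 <= last 2 J)%N by case: (J) lastJ.
have [[K [eJ admK lastK]]|[I [admI lastI spI eI hI]]] := IH admJ lastJ' nsJ; last first.
  right; exists (j :: I); split=> //=.
  - by rewrite admissible_cons j_gt0 hI hJ.
  - by case: (I) spI lastI.
  - by rewrite spI orbT.
  - by rewrite (negbTE nsj) eI.
set n := size J in eJ admK *; set b := (2 ^ n.+1 + 1)%N in admK.
have b_sp : special b by apply/specialP; exists n.
(* A large [j] may precede [b], so the unwound part stops here; a smaller [j] is absorbed into
   [K]. *)
have [le_bj|lt_jb] := leqP (2 * b) j.
  right; exists (j :: b :: K); split=> //=.
  - by rewrite admissible_cons j_gt0 admK le_bj.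
  - by case: (K) lastK => //= _; rewrite /b addn1 ltnS expn_gt0.
  - by rewrite b_sp orbT.
  - by rewrite (negbTE nsj) b_sp trunc_log_special /= -eJ.
left; move: (admK); rewrite admissible_cons => /and3P[_ hK admK'].
have le_jb : (2 ^ n.+1 + 2 * head 0 K <= j)%N.
  case en: n eJ => [|n'] eJ.
    suff -> : K = [::] by case: (J) lastJ eJ => //= jj; rewrite expn1; lia.
    case: (K) lastK hK admK' => // k [|k' K'] /= ; rewrite /b en expn1; first by lia.
    by rewrite !admissible_cons /=; lia.
  by move: hJ; rewrite eJ /= [(2 ^ n'.+2)%N]expnS; lia.
(* As [j] is not special, [j <= 2^(n+2)], which keeps the new sequence admissible, and [j - 2^(n+1)]
   is not 1. *)
have j_ne n' : j <> (2 ^ n'.+1 + 1)%N by move=> e; case/specialP: nsj; exists n'.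
have := j_ne n; have := j_ne n.+1; rewrite [(2 ^ n.+2)%N]expnS => j_ne1 j_ne2.
(* Here the new entry would be 0, which is encoded by the empty sequence. *)
have [ej|ne_j] := eqVneq j (2 ^ n.+1)%N.
  have K0 : K = [::].
    case: (K) le_jb admK' => // k K' /=; rewrite admissible_cons => + /and3P[+ _ _].
    by rewrite ej; lia.
  exists [::]; split=> //=; first by rewrite ej eJ K0.
  by rewrite admissible_cons addn1.
exists ((j - 2 ^ n.+1)%N :: K); split=> //=.
- by rewrite -eJ subnK //; lia.
- rewrite !admissible_cons admK' andbT /=; rewrite /b in lt_jb.
  by move: ne_j => /eqP; lia.
- by case: (K) lastK => //= _; move: ne_j => /eqP; lia.
Qed.

(** The lexicographic order alone is not well-founded, as (2) > (1,2) > (1,1,2) > ... shows. In a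
    fixed degree it is: induct on the degree, then on the first entry, then on the tail, which has
    smaller degree. *)
Lemma lex_ind (P : seq nat -> Prop) :
  (forall I, admissible I -> (forall K, lower I K -> P K) -> P I) ->
  forall I, admissible I -> P I.
Proof.
move=> step I; have [d dI] : exists d, sumn I = d by exists (sumn I).
elim/ltn_ind: d P I step dI => d IHd P I step dI.
case: I dI => [|i I] dI; first by move=> admI; apply: step => // K [_ _]; case: K.
elim/ltn_ind: i I dI => i IHi I dI admI.
have [i_gt0 _ admI'] := and3P (etrans (esym (admissible_cons i I)) admI).
apply: (IHd (sumn I) _ (fun K => sumn (i :: K) = d -> admissible (i :: K) -> P (i :: K)) I) => //.
  by move: dI => /=; lia.
move=> K _ IHK dK admK; apply: step => // -[|m M] [admM sumM ltM].
  by move: sumM => /=; lia.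
move: ltM => /= /orP[lt_mi|/andP[/eqP em ltM]].
  by apply: IHi => //; rewrite sumM.
rewrite {}em in admM sumM *; apply: IHK => //; last by rewrite sumM.
split=> //; last by move: sumM => /= /addnI.
by move: admM; rewrite admissible_cons => /and3P[].
Qed.

(** * Spanning by admissible monomials and parity of multiplicities *)

Lemma free_SqI_word (w : {fmonom nat}) : << w >> = free_SqI w.
Proof.
case: w => s; rewrite /free_SqI /=; elim: s => [|i s IH].
  by rewrite big_nil; congr (<< _ >>); apply: val_inj; rewrite /= fm1.
rewrite big_cons -IH malgM_def fgmulUU mulr1; congr (<< _ >>).
by apply: val_inj; rewrite /= fmM fmU.
Qed.

Lemma SqI_spans_admissible I : spans admissible (SqI I).
Proof.
elim: I => [|i I IH]; first exact: spans_SqI.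
rewrite SqI_cons; apply: spans_mull IH => J admJ.
by apply: spansS (Sq_mul_admissible i admJ) => K [].
Qed.

Lemma spans_admissible x : spans admissible x.
Proof.
rewrite -[x]reprK [repr x]monalgE (big_morph _ steenrod_piD steenrod_pi0).
apply: spans_sum => w _; case: (repr x)@_w => -[|[|//]] i.
  have -> : Ordinal i = 0 by exact: val_inj.
  by rewrite monalgU0 steenrod_pi0; exact: spans0.
have -> : Ordinal i = 1 by exact: val_inj.
by rewrite free_SqI_word pi_free_SqI; exact: SqI_spans_admissible.
Qed.

Lemma SqSum_odd_count s : SqSum s = SqSum [seq I <- undup s | odd (count_mem I s)].
Proof.
rewrite /SqSum -big_undup_iterop_count big_filter [RHS]big_mkcond.
apply: eq_bigr => I _; rewrite -[LHS]/(SqI I *+ count_mem I s).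
rewrite -{1}(odd_double_half (count_mem I s)) mulrnDr -addnn mulrnDr.
by rewrite steenrod_addxx addr0; case: odd.
Qed.

Lemma SqSum_uniq s : exists t, [/\ uniq t, {subset t <= s} & SqSum s = SqSum t].
Proof.
exists [seq I <- undup s | odd (count_mem I s)]; split.
- by rewrite filter_uniq ?undup_uniq.
- by move=> I; rewrite mem_filter mem_undup => /andP[].
- exact: SqSum_odd_count.
Qed.

(** Independence in the form used for relations with repetitions: an entry of odd multiplicity
    refutes a vanishing sum. *)
Lemma count_SqSum0 s I : (forall J, J \in s -> admissible J) -> SqSum s = 0 ->
  ~~ odd (count_mem I s).
Proof.
move=> admS; rewrite SqSum_odd_count => s0.
have : I \in [seq I <- undup s | odd (count_mem I s)] = false.
  rewrite (SqSum_free _ _ s0) ?filter_uniq ?undup_uniq // => J.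
  by rewrite mem_filter mem_undup => /andP[_ /admS].
rewrite mem_filter mem_undup; case: (boolP (I \in s)) => [_|/count_memPn -> //].
by rewrite andbT => ->.
Qed.

Lemma steenrod_addKl (x y z : steenrod) : x + z = (x + y) + (y + z).
Proof. by rewrite -addrA [y + (y + z)]addrA steenrod_addxx add0r. Qed.

Lemma SqSum_cat s t : SqSum (s ++ t) = SqSum s + SqSum t.
Proof. by rewrite /SqSum big_cat. Qed.

(** * Bases of the quotients *)

Definition in_left_ideal2 (u v x : steenrod) : Prop := exists a b, x = a * u + b * v.

Section LeftIdeal2.
Variables u v : steenrod.
Local Notation N := (in_left_ideal2 u v).

Lemma in_left_ideal2_0 : N 0.
Proof. by exists 0, 0; rewrite !mul0r addr0. Qed.

Lemma in_left_ideal2D x y : N x -> N y -> N (x + y).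
Proof. by move=> [a [b ->]] [c [d ->]]; exists (a + c), (b + d); rewrite !mulrDl addrACA. Qed.

Lemma in_left_ideal2M a x : N x -> N (a * x).
Proof. by move=> [b [c ->]]; exists (a * b), (a * c); rewrite mulrDr !mulrA. Qed.

Lemma in_left_ideal2l a : N (a * u).
Proof. by exists a, 0; rewrite mul0r addr0. Qed.

Lemma in_left_ideal2r a : N (a * v).
Proof. by exists 0, a; rewrite mul0r add0r. Qed.

Definition spans_mod (P : seq nat -> Prop) (x : steenrod) : Prop :=
  exists2 y, spans P y & N (x + y).

Lemma spans_mod_sum P s :
  (forall I, I \in s -> spans_mod P (SqI I)) -> spans_mod P (SqSum s).
Proof.
move=> sP; rewrite /SqSum big_seq; apply: big_ind => //.
  by exists 0; [exact: spans0 | rewrite addr0; exact: in_left_ideal2_0].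
move=> x y [x' xP xN] [y' yP yN]; exists (x' + y'); first exact: spansD.
by rewrite addrACA; exact: in_left_ideal2D.
Qed.
End LeftIdeal2.

Lemma Sq1Sq1 : Sq 1 * Sq 1 = 0.
Proof. by rewrite Sq_adem // big_ord1 /= mulr0n. Qed.

Lemma Sq1Sq2 : Sq 1 * Sq 2 = Sq 3.
Proof. by rewrite Sq_adem // big_ord1 /= Sq0 mulr1. Qed.

Lemma Sq1Sq3 : Sq 1 * Sq 3 = 0.
Proof. by rewrite Sq_adem // big_ord1 /= Sq0 mulr1 [_ *+ _]steenrod_addxx. Qed.

Lemma Sq2Sq2 : Sq 2 * Sq 2 = Sq 3 * Sq 1.
Proof. by rewrite Sq_adem // big_ord_recl big_ord1 /= mulr0n add0r. Qed.

Lemma Sq3Sq3 : Sq 3 * Sq 3 = Sq 5 * Sq 1.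
Proof. by rewrite Sq_adem // big_ord_recl big_ord1 /= mulr0n add0r. Qed.

Lemma Q1E : Q1 = Sq 3 + Sq 2 * Sq 1.
Proof. by rewrite /Q1 Sq1Sq2. Qed.

Lemma Q1Q1 : exists a, Q1 * Q1 = a * Sq 1.
Proof.
(* Q_1 = Sq^3 + Sq^2 Sq^1, and Q_1 Sq^3 = Sq^5 Sq^1. *)
exists (Sq 5 + Q1 * Sq 2).
rewrite [X in _ * X]Q1E mulrDr {1}Q1E mulrDl Sq3Sq3 -mulrA Sq1Sq3 mulr0 addr0.
by rewrite [RHS]mulrDl mulrA.
Qed.

Lemma Q0Q1 : exists a, Sq 1 * Q1 = a * Sq 1.
Proof. by exists (Sq 3); rewrite Q1E mulrDr Sq1Sq3 add0r mulrA Sq1Sq2. Qed.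

Definition good m (I : seq nat) : Prop :=
  [/\ admissible I, avoids_2n1 I & last_ge m I].

(* The default value of [last] makes the condition vacuous on the empty sequence. *)
Lemma last_geP m I : last_ge m I <-> (m <= last m I)%N.
Proof.
rewrite /last_ge; case: I => [|i I] //=.
by split=> [->|].
Qed.

Lemma goodP m I : good m I <-> [/\ admissible I, ~~ has special I & (m <= last m I)%N].
Proof. by split=> -[? /avoids_special ? /last_geP]. Qed.

Lemma last_admissible m I : admissible I -> (0 < m)%N -> (0 < last m I)%N.
Proof.
rewrite admissible_wadm => /andP[_ /allP I_gt0] m_gt0.
by have := mem_last m I; rewrite inE => /orP[/eqP->|/I_gt0].
Qed.

Lemma SqI_rcons I i : SqI (rcons I i) = SqI I * Sq i.
Proof. by rewrite -cats1 SqI_cat SqI_cons SqI_nil mulr1. Qed.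

(** A final 1 puts the monomial into A Q_0. If there is a special entry, [Sq_rewind] passes to lower
    monomials, because Sq^3 = Sq^2 Q_0 + Q_1 lies in the ideal. *)
Lemma E1_spans_mod I : admissible I -> spans_mod Q0 Q1 (good 2) (SqI I).
Proof.
elim/lex_ind=> {}I admI IH; have := last_admissible admI (isT : (0 < 2)%N).
case: (ltngtP (last 2 I) 1) => [|lastI|last1] // _; last first.
  exists 0; first exact: spans0.
  case/lastP: I last1 {admI IH} => // I i; rewrite last_rcons => ->.
  by rewrite addr0 SqI_rcons; exact: in_left_ideal2l.
have [spI|nsI] := boolP (has special I); last first.
  exists (SqI I); first by apply/spans_SqI/goodP.
  by rewrite steenrod_addxx; exact: in_left_ideal2_0.
have [z [s sI ->] zE] := Sq_rewind admI lastI spI.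
have [y yG yN] : spans_mod Q0 Q1 (good 2) (SqSum s).
  by apply: spans_mod_sum => K /sI; exact: IH.
exists y => //.
have -> : SqI I + y = SqI (rewind I) * Sq 3 + (SqSum s + y).
  by rewrite zE addrA -[SqI I + _ + _]addrA steenrod_addxx addr0.
apply: in_left_ideal2D yN; rewrite (_ : Sq 3 = Sq 2 * Q0 + 1 * Q1).
  by apply: in_left_ideal2M; exists (Sq 2), 1.
by rewrite mul1r Q1E addrC -addrA steenrod_addxx addr0.
Qed.

Lemma E1_spans_mod_all x : spans_mod Q0 Q1 (good 2) x.
Proof.
have [s sA ->] := spans_admissible x.
by apply: spans_mod_sum => I /sA; exact: E1_spans_mod.
Qed.

Lemma in_left_ideal2_E1_A1 x :
  in_left_ideal2 Q0 Q1 x -> in_left_ideal2 (Sq 1) (Sq 2) x.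
Proof.
case=> [a [b ->]]; exists (a + b * Sq 2), (b * Sq 1).
by rewrite mulrDl /Q1 mulrDr !mulrA addrAC addrA.
Qed.

Lemma A1_spans_mod_all x : spans_mod (Sq 1) (Sq 2) (good 4) x.
Proof.
have [_ [s sG ->] /in_left_ideal2_E1_A1 xN] := E1_spans_mod_all x.
have [y yG yN] : spans_mod (Sq 1) (Sq 2) (good 4) (SqSum s).
  apply: spans_mod_sum => I /sG gI; have [admI nsI lastI] := (goodP 2 I).1 gI.
  have [last4|lt4] := leqP 4 (last 4 I).
    exists (SqI I); first by apply/spans_SqI/goodP.
    by rewrite steenrod_addxx; exact: in_left_ideal2_0.
  exists 0; first exact: spans0.
  rewrite addr0; case/lastP: I lastI lt4 nsI {gI admI} => // I i.
  rewrite !last_rcons has_rcons negb_or SqI_rcons => i_ge i_lt /andP[nsi _].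
  (* Only 2 and 3 are possible, and 3 = 2^1 + 1 is special. *)
  have -> : i = 2%N.
    case: i i_ge i_lt nsi => [|[|[|[|]]]] // _ _ /specialP[]; by exists 0%N.
  exact: in_left_ideal2r.
exists y => //; rewrite (steenrod_addKl x (SqSum s)).
exact: in_left_ideal2D xN yN.
Qed.

(** * Linear independence in the quotients *)

Lemma lexlt_irr I : lexlt I I = false.
Proof. by elim: I => //= i I ->; rewrite ltnn eqxx. Qed.

Lemma lexlt_trans : transitive lexlt.
Proof.
elim=> [|j J IH] [|i I] [|k K] //= /orP[ltij|/andP[/eqP-> ltIJ]].
  by case/orP=> [ltjk|/andP[/eqP<- _]]; rewrite ?ltij // (ltn_trans ltij ltjk).
case/orP=> [->//|/andP[-> ltJK]]; rewrite (IH _ _ ltIJ ltJK).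
by rewrite orbT.
Qed.

Lemma lexlt_max (r : seq (seq nat)) : r != [::] ->
  exists2 I, I \in r & forall J, J \in r -> ~~ lexlt I J.
Proof.
elim: r => // I [|I' r] IH _.
  by exists I; rewrite ?mem_head // => J; rewrite inE => /eqP ->; rewrite lexlt_irr.
have [M Mr maxM] := IH isT; have [ltMI|nltMI] := boolP (lexlt M I).
  exists I; rewrite ?mem_head // => J; rewrite in_cons => /orP[/eqP->|Jr].
    by rewrite lexlt_irr.
  by apply: contra (maxM _ Jr); exact: lexlt_trans.
exists M; first by rewrite in_cons Mr orbT.
by move=> J; rewrite in_cons => /orP[/eqP->|/maxM].
Qed.

(** Appending 1 preserves admissibility unless the sequence already ends in 1, and then Sq^1 Sq^1 =
    0 applies. *)
Lemma spans_mul_Sq1 a : spans (fun I => admissible I /\ last 2 I = 1%N) (a * Sq 1).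
Proof.
have [s sA ->] := spans_admissible a.
rewrite /SqSum mulr_suml big_seq; apply: spans_sum => I /sA admI.
rewrite -SqI_rcons; case/lastP: I admI => [|I i] admI.
  exact: spans_SqI.
have [->|i_ne1] := eqVneq i 1%N.
  by rewrite !SqI_rcons -mulrA Sq1Sq1 mulr0; exact: spans0.
apply: spans_SqI; split; last by rewrite last_rcons.
move: admI; rewrite !admissible_wadm /wadm !all_rcons /= => /and3P[wI i_gt0 ->].
case: I wI => [|k I] /=; first by rewrite i_gt0 !andbT; lia.
by rewrite !rcons_path last_rcons i_gt0 => /andP[-> ->] /=; lia.
Qed.

(** Preimages chosen by [rewind_onto] are distinct because their images under [rewind] are. *)
Lemma uniq_lift_rewind t : uniq t -> (forall J, J \in t -> good 2 J) ->
  exists r, [/\ uniq r, map rewind r = t & forall I, I \in r ->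
    [/\ admissible I, (2 <= last 2 I)%N & has special I]].
Proof.
move=> ut tG; suff [r er rP] : exists2 r, map rewind r = t & forall I, I \in r ->
    [/\ admissible I, (2 <= last 2 I)%N & has special I].
  by exists r; split=> //; apply: (@map_uniq _ _ rewind); rewrite er.
elim: t {ut} tG => [|J t IH] tG; first by exists [::].
have [|r <- rP] := IH; first by move=> K Kt; apply: tG; rewrite inE Kt orbT.
have /goodP[admJ nsJ lastJ] := tG J (mem_head _ _).
have [I [admI lastI spI <-]] := rewind_onto admJ lastJ nsJ.
by exists (I :: r) => // K; rewrite inE => /orP[/eqP-> //|/rP].
Qed.

Lemma E1_free s : uniq s -> (forall I, I \in s -> good 2 I) ->
  in_left_ideal2 Q0 Q1 (SqSum s) -> s = [::].
Proof.
move=> us sG [a [b sE]].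
have [_ [t' t'G ->] [c [d bE]]] := E1_spans_mod_all b.
have [t [ut tt' et]] := SqSum_uniq t'.
have tG J : J \in t -> good 2 J by move/tt'/t'G.
have [r [ur er rP]] := uniq_lift_rewind ut tG.
have [e1 Q0Q1E] := Q0Q1; have [e2 Q1Q1E] := Q1Q1.
have rE : exists2 z, spans (fun K => exists2 I, I \in r & lower I K) z &
   SqSum t * Sq 3 = SqSum r + z.
  rewrite -er; elim: (r) rP => [|I r' IH] rP'.
    by exists 0; [exact: spans0 | rewrite /SqSum !big_nil mul0r addr0].
  have [admI lastI spI] := rP' I (mem_head _ _).
  have [z zP zE] := Sq_rewind admI lastI spI.
  have [|z' zP' zE'] := IH; first by move=> K Kr; apply: rP'; rewrite inE Kr orbT.
  exists (z + z').
    apply: spansD; first by apply: spansS zP => K lK; exists I; rewrite ?mem_head.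
    by apply: spansS zP' => K [M Mr lK]; exists M; rewrite // inE Mr orbT.
  by rewrite /SqSum /= !big_cons mulrDl zE -!/(SqSum _) zE' addrACA.
have [_ [low lowP ->] lowE] := rE.
have [u uP uE] : spans (fun I => admissible I /\ last 2 I = 1%N)
    (SqSum s + SqSum r + SqSum low).
  suff [e ->] : exists e, SqSum s + SqSum r + SqSum low = e * Sq 1 by exact: spans_mul_Sq1.
  (* The summands come from a Q_0, from c Q_0 Q_1, from d Q_1^2, and from the term Sq^2 Sq^1 of Q_1
     multiplied by [SqSum t]. *)
  exists (a + c * e1 + d * e2 + SqSum t * Sq 2).
  have {}bE : b = c * Q0 + d * Q1 + SqSum t.
    by rewrite -bE et -addrA steenrod_addxx addr0.
  rewrite -addrA -lowE sE {}bE !mulrDl -!mulrA Q0Q1E Q1Q1E [in _ * Q1]Q1E mulrDr.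
  set X := SqSum t * Sq 3; rewrite !addrA addrAC -[_ + X + X]addrA steenrod_addxx.
  by rewrite addr0.
have sum0 : SqSum (s ++ r ++ low ++ u) = 0.
  by rewrite !SqSum_cat !addrA -uE steenrod_addxx.
have adm L : L \in s ++ r ++ low ++ u -> admissible L.
  rewrite !mem_cat => /or4P[/sG[]|/rP[]|/lowP[? _ []]|/uP[]] //.
have r0 : r = [::].
  (* A maximal element of [r] occurs exactly once in the relation: it is special, unlike those of
     [s], below no element of [r], unlike those of [low], and does not end in 1, unlike those of
     [u]. *)
  apply/eqP; apply/negPn/negP => /lexlt_max[I Ir maxI].
  have [_ lastI spI] := rP _ Ir.
  have := count_SqSum0 I adm sum0; rewrite !count_cat (count_uniq_mem _ ur) Ir.
  rewrite !(count_memPn _) //.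
  - by apply/negP => /uP[_ last1]; rewrite last1 in lastI.
  - by apply/negP => /lowP[M Mr [_ _]]; apply/negP/maxI.
  - by apply/negP => /sG/goodP[_]; rewrite spI.
have low0 : low = [::].
  by case: (low) lowP => // K low' lowP; have [M] := lowP K (mem_head _ _); rewrite r0.
(* Only [s] and [u] remain, and their last entries keep them apart. *)
case: s us sG adm sum0 {sE uE} => // I s us sG adm sum0.
have := count_SqSum0 I adm sum0.
rewrite r0 low0 !cat0s count_cat (count_uniq_mem _ us) mem_head (count_memPn _) //.
apply/negP => /uP[_ last1]; have /goodP[_ _] := sG I (mem_head _ _).
by rewrite last1.
Qed.

Lemma A1_free s : uniq s -> (forall I, I \in s -> good 4 I) ->
  in_left_ideal2 (Sq 1) (Sq 2) (SqSum s) -> s = [::].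
Proof.
move=> us sG [a [b sE]].
have [_ [t' t'G ->] [c [d bE]]] := A1_spans_mod_all b.
have [t [ut tt' et]] := SqSum_uniq t'.
have tG J : J \in t -> good 4 J by move/tt'/t'G.
have tE : SqSum [seq rcons J 2%N | J <- t] = SqSum t * Sq 2.
  by rewrite /SqSum big_map mulr_suml; apply: eq_bigr => J _; rewrite SqI_rcons.
suff : s ++ [seq rcons J 2%N | J <- t] = [::] by case: (s).
apply: E1_free.
- rewrite cat_uniq us map_inj_uniq ?ut ?andbT; last exact: rcons_injl.
  apply/hasPn => _ /mapP[J _ ->]; apply/negP => /sG/goodP[_ _].
  by rewrite last_rcons.
- move=> I; rewrite mem_cat => /orP[/sG/goodP[admI nsI lastI]|].
    apply/goodP; split=> //.
    by case: (I) lastI => //= k K; apply: leq_trans.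
  case/mapP => J /tG/goodP[admJ nsJ lastJ] ->; apply/goodP; split.
  + move: admJ; rewrite !admissible_wadm /wadm !all_rcons /= => /andP[wJ ->].
    case: J wJ lastJ {nsJ} => //= k K; rewrite rcons_path => -> /=; lia.
  + by rewrite has_rcons negb_or nsJ andbT.
  + by rewrite last_rcons.
(* From Sq^2 Sq^2 = Sq^3 Q_0 and Sq^1 Sq^2 = Sq^3 = Q_1 + Sq^2 Q_0. *)
exists (a + c * Sq 2 + d * Sq 3), c.
have {}bE : b = c * Sq 1 + d * Sq 2 + SqSum t.
  by rewrite -bE et -addrA steenrod_addxx addr0.
rewrite SqSum_cat tE sE {}bE !mulrDl !addrA -[_ + _ + SqSum t * _]addrA.
rewrite steenrod_addxx addr0 -!mulrA Sq2Sq2 Sq1Sq2 Q1E mulrDr.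
set X := c * (Sq 2 * Sq 1).
by rewrite [c * _ + X]addrC [_ + X + d * _]addrAC -steenrod_addKl addrAC.
Qed.

(** * Augmentation and the left ideals of positive-degree elements *)

Definition steenrod_aug (x : steenrod) : 'F_2 := augmentation (repr x).

Lemma augmentation_ideal f : f \in steenrod_ideal -> augmentation f = 0.
Proof.
case/two_sided_idealP => s sR ->; rewrite rmorph_sum big_seq big1 // => t /sR tR.
by rewrite !rmorphM (augmentation_relation tR) mulr0 mul0r.
Qed.

Lemma steenrod_aug_pi f : steenrod_aug (\pi_steenrod f) = augmentation f.
Proof.
apply/eqP; rewrite -subr_eq0 -rmorphB; apply/eqP/augmentation_ideal.
by rewrite -steenrod_piE reprK.
Qed.

Lemma steenrod_augD x y : steenrod_aug (x + y) = steenrod_aug x + steenrod_aug y.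
Proof.
by rewrite -[x]reprK -[y]reprK -steenrod_piD !steenrod_aug_pi rmorphD.
Qed.

Lemma steenrod_augM x y : steenrod_aug (x * y) = steenrod_aug x * steenrod_aug y.
Proof.
by rewrite -[x]reprK -[y]reprK -steenrod_piM !steenrod_aug_pi rmorphM.
Qed.

Lemma steenrod_augZ1 c : steenrod_aug (c *: 1) = c.
Proof.
rewrite (_ : 1 = \pi_steenrod 1) // -steenrod_piZ steenrod_aug_pi.
by rewrite augmentation_scale rmorph1 mulr1.
Qed.

Lemma homogeneous_aug d x : (0 < d)%N -> homogeneous d x -> steenrod_aug x = 0.
Proof.
move=> d_gt0 [f fd ->]; rewrite steenrod_aug_pi /augmentation /= mmapE.
rewrite big_seq big1 // => w; rewrite -mcoeff_neq0 => /fd dw.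
rewrite /word_augmentation; case: allP => [w0|_]; last by rewrite mulr0.
suff w_0 : sumn w = 0%N by rewrite -dw w_0 in d_gt0.
by elim: (w : seq nat) w0 => //= i I IH w0; rewrite (eqP (w0 i _)) ?mem_head // IH
  // => j jI; apply: w0; rewrite inE jI orbT.
Qed.

Lemma homogeneous_SqI I : homogeneous (sumn I) (SqI I).
Proof.
exists (free_SqI I); last by rewrite pi_free_SqI.
move=> w; have -> : free_SqI I = << fmonom_of_seq fmonom_key I >>.
  by rewrite free_SqI_word fmE.
by rewrite mcoeffU1; case: (_ =P w) => [<- _|]; rewrite ?fmE ?eqxx.
Qed.

Lemma homogeneousD d x y : homogeneous d x -> homogeneous d y -> homogeneous d (x + y).
Proof.
move=> [f fd ->] [g gd ->]; exists (f + g); last by rewrite steenrod_piD.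
move=> w; rewrite mcoeffD; have [/eqP f0|/fd //] := boolP (f@_w == 0).
by rewrite f0 add0r; exact: gd.
Qed.

Section GeneratedLeftIdeal.
Variables (u v : steenrod).
Let B := subalgebra (fun x => x = u \/ x = v).

Lemma subalgebra_left_ideal2 x : B x ->
  exists c : 'F_2, in_left_ideal2 u v (x + c *: 1).
Proof.
elim=> {x} [x [->|->]||x y _ [c xN] _ [d yN]|x y _ [c xN] _ [d yN]|c x _ [d xN]].
- by exists 0, 1, 0; rewrite scale0r addr0 mul1r mul0r addr0.
- by exists 0, 0, 1; rewrite scale0r addr0 mul1r mul0r add0r.
- by exists 1; rewrite scale1r steenrod_addxx; exact: in_left_ideal2_0.
- exists (c + d); have -> : x + y + (c + d) *: 1 = (x + c *: 1) + (y + d *: 1).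
    rewrite scalerDl.
    exact: addrACA.
  exact: in_left_ideal2D xN yN.
- exists (d * c).
  have -> : x * y + (d * c) *: 1 = x * (y + d *: 1) + (d *: 1) * (x + c *: 1).
    rewrite mulrDr -scalerAr mulr1 -scalerAl mul1r scalerDr scalerA.
    exact: steenrod_addKl.
  by apply: in_left_ideal2D; exact: in_left_ideal2M.
- exists (c * d); rewrite -scalerA -scalerDr -[x + _]mul1r scalerAl.
  exact: in_left_ideal2M.
Qed.

(** An element of the subalgebra is a scalar c modulo A u + A v. In positive degree the augmentation
    kills it, as well as u and v, so c = 0. *)
Lemma left_ideal_generated x :
  steenrod_aug u = 0 -> steenrod_aug v = 0 ->
  (exists2 d, (0 < d)%N & homogeneous d u) ->
  (exists2 d, (0 < d)%N & homogeneous d v) ->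
  (x \in left_ideal (positive_part B)) <-> in_left_ideal2 u v x.
Proof.
move=> u0 v0 hu hv; split; last first.
  case=> [a [b ->]]; apply/left_idealP; exists [:: (a, u); (b, v)].
    move=> t; rewrite !inE => /orP[] /eqP -> /=; split=> //.
      by apply: subalgebra_gen; left.
    by apply: subalgebra_gen; right.
  by rewrite !big_cons big_nil addr0.
case/left_idealP => s sG ->; rewrite big_seq; apply: big_ind.
- exact: in_left_ideal2_0.
- exact: in_left_ideal2D.
move=> t /sG[/subalgebra_left_ideal2[c [a [b e]]] [d d_gt0 hd]].
apply: in_left_ideal2M; exists a, b; rewrite -e.
suff -> : c = 0 by rewrite scale0r addr0.
rewrite -(steenrod_augZ1 c) -[_ *: 1]add0r -(steenrod_addxx t.2) -addrA e.
rewrite !(steenrod_augD, steenrod_augM) u0 v0 !mulr0 !addr0.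
exact: homogeneous_aug hd.
Qed.
End GeneratedLeftIdeal.

(** * Passage to bases of the quotient modules *)

Lemma quotient_basis (B G : _ -> Prop) u v :
  (forall x, x \in left_ideal (positive_part B) <-> in_left_ideal2 u v x) ->
  (forall s, uniq s -> (forall I, I \in s -> G I) ->
     in_left_ideal2 u v (SqSum s) -> s = [::]) ->
  (forall x, spans_mod u v G x) ->
  is_basis G (fun I : seq nat => \pi_(steenrod_mod B) (SqI I)).
Proof.
move=> idealE freeG spanG.
have pi0 : \pi_(steenrod_mod B) 0 = 0.
  by apply: (addrI (\pi_(steenrod_mod B) 0)); rewrite -left_quotient_piD !addr0.
split=> [s c us sG sum0 j js|v'].
  apply/eqP; apply/negPn/negP => cj.
  have s0 : [seq I <- s | c I != 0] = [::].
    apply: freeG; first exact: filter_uniq.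
      by move=> I; rewrite mem_filter => /andP[_ /sG].
    apply/idealE; rewrite -[SqSum _]subr0 -left_quotient_piE; apply/eqP.
    rewrite pi0 -[RHS]sum0 /SqSum big_filter.
    rewrite (big_morph _ (@left_quotient_piD _ _ _) pi0) big_mkcond.
    apply: eq_bigr => I _; case: (c I) => -[|[|//]] i.
      by rewrite (_ : Ordinal i = 0) ?eqxx ?scale0r //; exact: val_inj.
    by rewrite (_ : Ordinal i = 1) ?scale1r //; exact: val_inj.
  by have := mem_filter (fun I => c I != 0) j s; rewrite s0 cj js.
have [_ [s sG ->] xN] := spanG (repr v').
exists s, (fun=> 1); split=> //; rewrite -[LHS]reprK.
have /eqP -> : \pi_(steenrod_mod B) (repr v') == \pi_(steenrod_mod B) (SqSum s).
  by rewrite left_quotient_piE steenrod_opp; apply/idealE.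
rewrite /SqSum (big_morph _ (@left_quotient_piD _ _ _) pi0).
by apply: eq_bigr => I _; rewrite scale1r.
Qed.

Theorem theorem1p1 :
  is_basis (fun I : seq nat => [/\ admissible I, avoids_2n1 I & last_ge 4 I])
           (fun I : seq nat => \pi_(steenrod_mod A1) (SqI I))
  /\
  is_basis (fun I : seq nat => [/\ admissible I, avoids_2n1 I & last_ge 2 I])
           (fun I : seq nat => \pi_(steenrod_mod E1) (SqI I)).
Proof.
have hom_Sq i : (0 < i)%N -> exists2 d, (0 < d)%N & homogeneous d (Sq i).
  move=> i_gt0; exists i => //; rewrite -[Sq i]mulr1 -SqI_nil -SqI_cons.
  by rewrite -{1}[i]addn0; exact: (homogeneous_SqI [:: i]).
have hom_Q1 : exists2 d, (0 < d)%N & homogeneous d Q1.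
  exists 3%N => //; rewrite /Q1; apply: homogeneousD.
    by rewrite -[Sq 2]mulr1 -SqI_nil -!SqI_cons; exact: (homogeneous_SqI [:: 1; 2]%N).
  by rewrite -[Sq 1]mulr1 -SqI_nil -!SqI_cons; exact: (homogeneous_SqI [:: 2; 1]%N).
have aug0 x : (exists2 d, (0 < d)%N & homogeneous d x) -> steenrod_aug x = 0.
  by case=> d; exact: homogeneous_aug.
split; apply: quotient_basis.
- by move=> x; apply: left_ideal_generated; do ?apply: aug0; exact: hom_Sq.
- exact: A1_free.
- exact: A1_spans_mod_all.
- by move=> x; apply: left_ideal_generated; do ?apply: aug0; rewrite ?/Q0 //; exact: hom_Sq.
- exact: E1_free.
- exact: E1_spans_mod_all.
Qed.
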